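(* Let $A$ be a formula of TCF. Then $$\{\forall_{\vec x}(\neg Y\vec x\to Y'\vec x)\mid Y\in\mathbf{PP}(A)\}\ \vdash_{\mathrm c}\ \neg A\to A^{\mathbf N},$$ where $\vdash_{\mathrm c}$ denotes classical derivability.
   Context: **Types and terms of TCF.** Types are $\rho,\sigma::=\alpha\mid\rho\to\sigma\mid\iota$, with $\alpha$ type variables and $\iota=\langle C_i:\vec\rho_i[\beta/\iota]\to\iota\rangle_{i<k}$ free algebras given by constructors, $\beta$ occurring at most strictly positively in each argument type; e.g. the booleans $\mathbb B$ with constructors $\mathtt f,\mathtt t$. Terms are simply typed: $t,s::=x^\rho\mid\lambda_xt\mid ts\mid C_i\mid D$, where $D$ ranges over program constants introduced by finitely many computation rules $D\vec P_i:=t_i$ with $\vec P_i$ constructor patterns (built from variables and constructors), non-unifiable for different $i$. Computation need not terminate (terms are partial). Terms are identified up to renaming, $\beta$-equality and computation rules. **Formulas and predicates** are defined simultaneously by $$P::=X\mid\{\vec x\mid A\}\mid\mu_X\vec K\mid\nu_X\vec K,\qquad A,B::=P\vec t\mid A\to B\mid A\wedge B\mid A\vee B\mid\forall_xA\mid\exists_xA,$$ with $X$ predicate variables with arities (lists of types), $\vec x$ in $\{\vec x\mid A\}$ exactly the free term variables of $A$, and $\{\vec x\mid A\}\vec y$ identified with $A[\vec x/\vec y]$. $\vec K$ is a finite list of clauses $K_i=\forall_{\vec x_i}(A_{i0}(X)\to\dots\to A_{i,n_i-1}(X)\to X\vec t_i)$, $i<k$, without free term variables, where $X$ occurs at most strictly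 positively in each premise $A_{i\nu}$ (never free to the left of an implication, including inside the clauses of nested predicates). $\mu_X\vec K$ is an inductive, $\nu_X\vec K$ a coinductive predicate. Put $P\cap Q=\{\vec x\mid P\vec x\wedge Q\vec x\}$, $P\cup Q=\{\vec x\mid P\vec x\vee Q\vec x\}$, $P\subseteq Q:=\forall_{\vec x}(P\vec x\to Q\vec x)$. **Derivations.** Minimal natural deduction with the usual introduction and elimination axioms for $\wedge,\vee,\exists$, and the following axioms. For $I=\mu_X\vec K$: $\forall_{\vec x_i}(\vec A_i(I)\to I\vec t_i)$ for $i<k$, and for every predicate $P$ the induction axiom $\big(\forall_{\vec x_i}(\vec A_i(I\cap P)\to P\vec t_i)\big)_{i<k}\to I\subseteq P$. For $J=\nu_X\vec K$, with $\Phi(X)=\{\vec y\mid\bigvee_{i<k}\exists_{\vec x_i}(\vec y\equiv\vec t_i\wedge\bigwedge\vec A_i(X))\}$: $J\subseteq\Phi(J)$, and for every predicate $Q$, $Q\subseteq\Phi(J\cup Q)\to Q\subseteq J$. Leibniz equality is $\equiv\,:=\mu_X(\forall_xXxx)$; $\vec x\equiv\vec y$ is the componentwise conjunction; $\bot:=(\mathtt f\equiv\mathtt t)$; $\neg A:=A\to\bot$. $\Gamma\vdash A$ means $A$ is derivable from assumptions $\Gamma$. **Classical derivability.** $\Delta\vdash_{\mathrm c}A$ means that $\Delta\cup\mathbf{St}_\Gamma\vdash A$ for some finite collection $\Gamma$ of formulas, where $\mathbf{St}_\Gamma=\{\neg\neg B\to B\mid B\in\Gamma\}$ (free term variables of $B$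 understood as universally quantified). **Strong negation.** To each predicate variable $X$ are assigned new distinct predicate variables $X',X'',\dots$ of the same arity, with $(X^{(n)})'=X^{(n+1)}$ and $X^{(n)}\ne Y^{(m)}$ if $X\neq Y$. Define $(P\vec t)^{\mathbf N}=P^{\mathbf N}\vec t$, $(A\to B)^{\mathbf N}=A\wedge B^{\mathbf N}$, $(A\wedge B)^{\mathbf N}=A^{\mathbf N}\vee B^{\mathbf N}$, $(A\vee B)^{\mathbf N}=A^{\mathbf N}\wedge B^{\mathbf N}$, $(\forall_xA)^{\mathbf N}=\exists_xA^{\mathbf N}$, $(\exists_xA)^{\mathbf N}=\forall_xA^{\mathbf N}$, $X^{\mathbf N}=X'$, $\{\vec x\mid A\}^{\mathbf N}=\{\vec x\mid A^{\mathbf N}\}$. For a finite list of clauses $\vec K=\big(\forall_{\vec x_i}(A_{i0}(X)\to\dots\to A_{i,n_i-1}(X)\to X\vec t_i)\big)_{i<k}$ without free term variables, with $X$ at most strictly positive in each premise $A_{i\nu}$, let $E(X')(\vec y):=\bigwedge_{i<k}\forall_{\vec x_i}(\vec y\equiv\vec t_i\to B_i)$, where $B_i:=\bigvee_{\nu<n_i}A_{i\nu}^{\mathbf N}$ if $n_i>0$ and $B_i:=\bot$ if $n_i=0$. Then $(\mu_X\vec K)^{\mathbf N}$ is the greatest fixed point $\nu_{X'}\big(\forall_{\vec y}(X'\vec y\to E(X')(\vec y))\big)$ (i.e. the coinductive predicate with the single clause $\forall_{\vec y}(E(X')(\vec y)\to X'\vec y)$), and $(\nu_X\vec K)^{\mathbf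 N}$ is the inductive predicate $\mu_{X'}\big(\forall_{\vec y}(E(X')(\vec y)\to X'\vec y)\big)$. **Strictly positive free predicate variables** $\mathbf{PP}$: $\mathbf{PP}(X)=\{X\}$, $\mathbf{PP}(A\to B)=\mathbf{PP}(B)$, $\mathbf{PP}(A\wedge B)=\mathbf{PP}(A\vee B)=\mathbf{PP}(A)\cup\mathbf{PP}(B)$, $\mathbf{PP}(\forall_xA)=\mathbf{PP}(\exists_xA)=\mathbf{PP}(\{\vec x\mid A\})=\mathbf{PP}(A)$, $\mathbf{PP}(P\vec t)=\mathbf{PP}(P)$, and for $\mu_X\vec K$ and $\nu_X\vec K$ it is $\bigcup_{i,\nu}\mathbf{PP}(A_{i\nu})\setminus\{X\}$. *)

(* Defs.v *)
From Stdlib Require Import List.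
Import ListNotations.

Set Implicit Arguments.
Set Contextual Implicit.

(* Bound variables of all sorts are well-scoped de Bruijn variables, so that
   objects differing only in the names of bound variables are equal. *)

(* [mem l a] is the type of positions of [a] in [l]. *)
Inductive mem {A : Type} : list A -> A -> Type :=
| mz : forall a l, mem (a :: l) a
| ms : forall a b l, mem l a -> mem (b :: l) a.

Fixpoint idx {A : Type} {l : list A} {a : A} (m : mem l a) : nat :=
  match m with mz => 0 | ms m' => S (idx m') end.

Fixpoint mem_left {A : Type} {k l : list A} {a : A} (m : mem k a)
  : mem (k ++ l) a :=
  match m in mem k' a' return mem (k' ++ l) a' with
  | mz => mz
  | ms m' => ms (mem_left m')
  end.

Fixpoint mem_right {A : Type} (k : list A) {l : list A} {a : A} (m : mem l a)
  : mem (k ++ l) a :=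
  match k return mem (k ++ l) a with
  | [] => m
  | _ :: k' => ms (mem_right k' m)
  end.

Definition mem_nil {A B : Type} {a : A} (m : mem (@nil A) a) : B :=
  match m in mem l _ return match l with [] => B | _ => unit end with
  | mz => tt
  | ms _ => tt
  end.

Definition lift_ren {A : Type} {k l : list A} (b : A)
  (f : forall a, mem k a -> mem l a) (a : A) (m : mem (b :: k) a)
  : mem (b :: l) a :=
  match m in mem k' a'
    return match k' with
           | [] => unit
           | b' :: k'' => (forall a, mem k'' a -> mem l a) -> mem (b' :: l) a'
           end
  with
  | mz => fun _ => mz
  | ms m' => fun f => ms (f _ m')
  end f.

(** * Types *)

(* [ty V] are the types whose recursion variables (the variables beta bound by
   algebras) range over [V]; [TVar] are the type variables alpha.  An algebra is
   the list, over its constructors, of the lists of argument types, in which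
   [None] is the new recursion variable.  No recursion variable is in scope to
   the left of an arrow: this is the condition that beta occurs at most strictly
   positively in argument types. *)
Inductive ty (V : Set) : Set :=
| TVar (a : nat)
| TRec (v : V)
| Arr (r : ty Empty_set) (s : ty V)
| Alg (cs : list (list (ty (option V)))).

Fixpoint ty_ren {V W : Set} (f : V -> W) (t : ty V) : ty W :=
  match t with
  | TVar a => TVar a
  | TRec v => TRec (f v)
  | Arr r s => Arr r (ty_ren f s)
  | Alg cs => Alg (map (map (ty_ren (option_map f))) cs)
  end.

Definition ty_lift {V W : Set} (f : V -> ty W) (o : option V) : ty (option W) :=
  match o with
  | None => TRec None
  | Some v => ty_ren Some (f v)
  end.

Fixpoint ty_subst {V W : Set} (f : V -> ty W) (t : ty V) : ty W :=
  match t with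
  | TVar a => TVar a
  | TRec v => f v
  | Arr r s => Arr r (ty_subst f s)
  | Alg cs => Alg (map (map (ty_subst (ty_lift f))) cs)
  end.

Definition type : Set := ty Empty_set.

Definition ty_inst (u : type) (t : ty (option Empty_set)) : type :=
  ty_subst (fun o => match o with None => u | Some v => TRec v end) t.

Definition arrs (rs : list type) (s : type) : type :=
  fold_right (@Arr Empty_set) s rs.

Definition boole : type := Alg [ []; [] ].

Definition ctx : Set := list type.
Definition arity : Set := list type.

(** * Terms *)

(* Names and types of the program constants; [D] takes the arguments
   [pc_args D] on the left-hand sides of its computation rules. *)
Record constants : Type := {
  pconst : Type;
  pc_args : pconst -> list type;
  pc_res : pconst -> type
}.

Section Syntax.

Context {C : constants}.

Inductive tm (G : ctx) : type -> Type :=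
| Var : forall r, mem G r -> tm G r
| Lam : forall r s, tm (r :: G) s -> tm G (Arr r s)
| App : forall r s, tm G (Arr r s) -> tm G r -> tm G s
| Con : forall (cs : list (list (ty (option Empty_set)))) args, mem cs args ->
    tm G (arrs (map (ty_inst (Alg cs)) args) (Alg cs))
| Prog : forall D : pconst C, tm G (arrs (pc_args C D) (pc_res C D)).

Fixpoint tm_ren {G H : ctx} (f : forall r, mem G r -> mem H r) {s : type}
  (t : tm G s) : tm H s :=
  match t with
  | Var x => Var (f _ x)
  | Lam t => Lam (tm_ren (lift_ren f) t)
  | App t u => App (tm_ren f t) (tm_ren f u)
  | Con c => Con c
  | Prog D => Prog D
  end.

Definition tsub (G H : ctx) : Type := forall r, mem G r -> tm H r.

Definition tsub_cons {G H : ctx} {s : type} (u : tm H s) (f : tsub G H)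
  : tsub (s :: G) H := fun r x =>
  match x in mem G' r'
    return match G' with
           | [] => unit
           | s' :: G'' => tm H s' -> tsub G'' H -> tm H r'
           end
  with
  | mz => fun u _ => u
  | ms x' => fun _ f => f _ x'
  end u f.

Definition tsub_ren {G H : ctx} (f : forall r, mem G r -> mem H r) : tsub G H :=
  fun r x => Var (f r x).

Definition tsub_lift {G H : ctx} (s : type) (f : tsub G H)
  : tsub (s :: G) (s :: H) :=
  tsub_cons (Var mz) (fun r x => tm_ren (fun _ => @ms _ _ _ _) (f r x)).

Fixpoint tm_sub {G H : ctx} (f : tsub G H) {s : type} (t : tm G s) : tm H s :=
  match t with
  | Var x => f _ x
  | Lam t => Lam (tm_sub (tsub_lift f) t)
  | App t u => App (tm_sub f t) (tm_sub f u)
  | Con c => Con c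
  | Prog D => Prog D
  end.

(* The variable with de Bruijn index [n] is free in [t]. *)
Fixpoint tm_free (n : nat) {G : ctx} {s : type} (t : tm G s) : Prop :=
  match t with
  | Var x => idx x = n
  | Lam t => tm_free (S n) t
  | App t u => tm_free n t \/ tm_free n u
  | Con _ | Prog _ => False
  end.

Fixpoint tms (G : ctx) (ar : list type) : Type :=
  match ar with
  | [] => unit
  | r :: ar' => tm G r * tms G ar'
  end.

Fixpoint tms_sub {G H : ctx} (f : tsub G H) {ar : list type}
  : tms G ar -> tms H ar :=
  match ar with
  | [] => fun _ => tt
  | r :: ar' => fun ts => (tm_sub f (fst ts), tms_sub f (snd ts))
  end.

Fixpoint tms_vars {G : ctx} (ar : list type)
  : (forall r, mem ar r -> mem G r) -> tms G ar :=
  match ar with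
  | [] => fun _ => tt
  | r :: ar' => fun f =>
      (Var (f _ mz), tms_vars (ar := ar') (fun s x => f s (ms x)))
  end.

Fixpoint tsub_of {G : ctx} {ar : list type} : tms G ar -> tsub ar G :=
  match ar with
  | [] => fun _ r x => mem_nil x
  | r :: ar' => fun ts => tsub_cons (fst ts) (tsub_of (snd ts))
  end.

Fixpoint tms_all (P : forall G s, tm G s -> Prop) {G : ctx} {ar : list type}
  : tms G ar -> Prop :=
  match ar with
  | [] => fun _ => True
  | r :: ar' => fun ts => P _ _ (fst ts) /\ tms_all P (snd ts)
  end.

Fixpoint tms_free (n : nat) {G : ctx} {ar : list type} : tms G ar -> Prop :=
  match ar with
  | [] => fun _ => False
  | r :: ar' => fun ts => tm_free n (fst ts) \/ tms_free n (snd ts)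
  end.

Fixpoint apps {G : ctx} {rs : list type} {s : type}
  : tm G (arrs rs s) -> tms G rs -> tm G s :=
  match rs with
  | [] => fun t _ => t
  | r :: rs' => fun t us => apps (rs := rs') (App t (fst us)) (snd us)
  end.

(* Constructor patterns, as terms: a variable, or a constructor applied to
   constructor patterns. *)
Inductive is_pattern : forall G s, tm G s -> Prop :=
| pat_var : forall G s (x : mem G s), is_pattern (Var x)
| pat_con : forall G s (t : tm G s), is_con_pattern t -> is_pattern t
with is_con_pattern : forall G s, tm G s -> Prop :=
| cpat_con : forall G cs args (c : mem cs args), is_con_pattern (@Con G cs args c)
| cpat_app : forall G r s (t : tm G (Arr r s)) (u : tm G r),
    is_con_pattern t -> is_pattern u -> is_con_pattern (App t u).

Record rule (D : pconst C) : Type := {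
  rl_ctx : ctx;
  rl_lhs : tms rl_ctx (pc_args C D);
  rl_rhs : tm rl_ctx (pc_res C D)
}.

(* The variables in [rl_ctx] are exactly those of the patterns. *)
Definition rule_ok {D : pconst C} (R : rule D) : Prop :=
  tms_all is_pattern (rl_lhs R) /\
  forall n, n < length (rl_ctx R) -> tms_free n (rl_lhs R).

Definition non_unifiable {D : pconst C} (R R' : rule D) : Prop :=
  forall (G : ctx) (f : tsub (rl_ctx R) G) (f' : tsub (rl_ctx R') G),
    tms_sub f (rl_lhs R) <> tms_sub f' (rl_lhs R').

(** * Formulas and predicates *)

(* [Build_pvar b ar n] is the variable X^(n), for the b-th predicate variable X
   of arity [ar]. *)
Record pvar : Set := { pv_base : nat; pv_arity : arity; pv_level : nat }.

Definition prime (X : pvar) : pvar :=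
  {| pv_base := pv_base X; pv_arity := pv_arity X; pv_level := S (pv_level X) |}.

(* [fm D G] are the formulas with free term variables in [G]; [D] lists the
   arities of the predicate variables bound by an enclosing mu or nu, all other
   predicate variables being free and named ([PVar]).
   - The premise of an implication is in [fm [] G]: a predicate variable bound
     outside an implication does not occur to its left, which is the condition
     of strict positivity, imposed through all nested mu, nu.
   - Comprehensions {x | A} and clauses have no free term variables other than
     x, resp. the quantified variables of the clause.
   - [Cl xs As ts] is the clause forall xs (As_0 -> ... -> As_(n-1) -> X ts); in
     [Mu] and [Nu], X is the innermost bound predicate variable. *)
Inductive fm (D : list arity) : ctx -> Type :=
| Pr : forall G ar, pred D ar -> tms G ar -> fm D G
| Imp : forall G, fm [] G -> fm D G -> fm D G
| And : forall G, fm D G -> fm D G -> fm D G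
| Or : forall G, fm D G -> fm D G -> fm D G
| All : forall G r, fm D (r :: G) -> fm D G
| Ex : forall G r, fm D (r :: G) -> fm D G
with pred (D : list arity) : arity -> Type :=
| PVar : forall X : pvar, pred D (pv_arity X)
| PBnd : forall ar, mem D ar -> pred D ar
| Compr : forall ar, fm D ar -> pred D ar
| Mu : forall ar, list (clause (ar :: D) ar) -> pred D ar
| Nu : forall ar, list (clause (ar :: D) ar) -> pred D ar
with clause (D : list arity) : arity -> Type :=
| Cl : forall ar xs, list (fm D xs) -> tms xs ar -> clause D ar.

Fixpoint fm_sub {D : list arity} {G H : ctx} (f : tsub G H) (A : fm D G)
  : fm D H :=
  match A in fm _ G return tsub G H -> fm D H with
  | Pr P ts => fun f => Pr P (tms_sub f ts)
  | Imp A B => fun f => Imp (fm_sub f A) (fm_sub f B)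
  | And A B => fun f => And (fm_sub f A) (fm_sub f B)
  | Or A B => fun f => Or (fm_sub f A) (fm_sub f B)
  | All A => fun f => All (fm_sub (tsub_lift f) A)
  | Ex A => fun f => Ex (fm_sub (tsub_lift f) A)
  end f.

Definition fm_ren {D : list arity} {G H : ctx}
  (f : forall r, mem G r -> mem H r) (A : fm D G) : fm D H :=
  fm_sub (tsub_ren f) A.

Definition fm_wk {D : list arity} {G : ctx} (r : type) (A : fm D G)
  : fm D (r :: G) := fm_ren (fun _ => @ms _ _ _ _) A.

Definition fm_inst {D : list arity} {G : ctx} {r : type} (A : fm D (r :: G))
  (t : tm G r) : fm D G := fm_sub (tsub_cons t (fun _ => @Var _ _)) A.

Definition pren (D E : list arity) : Type := forall ar, mem D ar -> mem E ar.

Fixpoint fm_pren {D E : list arity} {G : ctx} (f : pren D E) (A : fm D G)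
  : fm E G :=
  match A in fm _ G return fm E G with
  | Pr P ts => Pr (pred_pren f P) ts
  | Imp A B => Imp A (fm_pren f B)
  | And A B => And (fm_pren f A) (fm_pren f B)
  | Or A B => Or (fm_pren f A) (fm_pren f B)
  | All A => All (fm_pren f A)
  | Ex A => Ex (fm_pren f A)
  end
with pred_pren {D E : list arity} {ar : arity} (f : pren D E) (P : pred D ar)
  : pred E ar :=
  match P in pred _ ar return pred E ar with
  | PVar X => PVar X
  | PBnd X => PBnd (f _ X)
  | Compr A => Compr (fm_pren f A)
  | Mu K => Mu (map (clause_pren (lift_ren f)) K)
  | Nu K => Nu (map (clause_pren (lift_ren f)) K)
  end
with clause_pren {D E : list arity} {ar : arity} (f : pren D E) (c : clause D ar)
  : clause E ar :=
  match c in clause _ ar return clause E ar with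
  | Cl As ts => Cl (map (fm_pren f) As) ts
  end.

Definition fm_open {D : list arity} {G : ctx} (A : fm [] G) : fm D G :=
  fm_pren (fun _ X => mem_nil X) A.

Definition psub (D E : list arity) : Type := forall ar, mem D ar -> pred E ar.

Definition psub_cons {D E : list arity} {ar : arity} (P : pred E ar)
  (f : psub D E) : psub (ar :: D) E := fun ar' X =>
  match X in mem D' ar'
    return match D' with
           | [] => unit
           | ar :: D'' => pred E ar -> psub D'' E -> pred E ar'
           end
  with
  | mz => fun P _ => P
  | ms X' => fun _ f => f _ X'
  end P f.

Definition psub_lift {D E : list arity} (ar : arity) (f : psub D E)
  : psub (ar :: D) (ar :: E) :=
  psub_cons (PBnd mz) (fun _ X => pred_pren (fun _ => @ms _ _ _ _) (f _ X)).

Fixpoint fm_psub {D E : list arity} {G : ctx} (f : psub D E) (A : fm D G)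
  : fm E G :=
  match A in fm _ G return fm E G with
  | Pr P ts => Pr (pred_psub f P) ts
  | Imp A B => Imp A (fm_psub f B)
  | And A B => And (fm_psub f A) (fm_psub f B)
  | Or A B => Or (fm_psub f A) (fm_psub f B)
  | All A => All (fm_psub f A)
  | Ex A => Ex (fm_psub f A)
  end
with pred_psub {D E : list arity} {ar : arity} (f : psub D E) (P : pred D ar)
  : pred E ar :=
  match P in pred _ ar return pred E ar with
  | PVar X => PVar X
  | PBnd X => f _ X
  | Compr A => Compr (fm_psub f A)
  | Mu K => Mu (map (clause_psub (psub_lift f)) K)
  | Nu K => Nu (map (clause_psub (psub_lift f)) K)
  end
with clause_psub {D E : list arity} {ar : arity} (f : psub D E) (c : clause D ar)
  : clause E ar :=
  match c in clause _ ar return clause E ar with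
  | Cl As ts => Cl (map (fm_psub f) As) ts
  end.

(* A(P), for A(X) with X the innermost bound predicate variable. *)
Definition fm_pinst {D : list arity} {ar : arity} {G : ctx} (P : pred D ar)
  (A : fm (ar :: D) G) : fm D G :=
  fm_psub (psub_cons P (fun _ => @PBnd _ _)) A.

(* The quantifier over the first type in [xs] is the innermost one. *)
Fixpoint Alls {D : list arity} (xs : list type) {G : ctx}
  : fm D (xs ++ G) -> fm D G :=
  match xs with
  | [] => fun A => A
  | r :: xs' => fun A => Alls xs' (All A)
  end.

Fixpoint Exs {D : list arity} (xs : list type) {G : ctx}
  : fm D (xs ++ G) -> fm D G :=
  match xs with
  | [] => fun A => A
  | r :: xs' => fun A => Exs xs' (Ex A)
  end.

Definition fm_left {D : list arity} {xs G : ctx} (A : fm D xs)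
  : fm D (xs ++ G) := fm_ren (fun _ => @mem_left _ _ _ _) A.

Definition Imps {G : ctx} (As : list (fm [] G)) (B : fm [] G) : fm [] G :=
  fold_right (@Imp [] G) B As.

Definition Eq {D : list arity} (r : type) : pred D [r; r] :=
  Mu [ Cl (xs := [r]) (ar := [r; r]) [] (Var mz, (Var mz, tt)) ].
Arguments Eq {D} r.

Definition ff {G : ctx} : tm G boole := @Con G [ []; [] ] [] mz.
Definition tru {G : ctx} : tm G boole := @Con G [ []; [] ] [] (ms mz).

Definition Bot {D : list arity} {G : ctx} : fm D G :=
  Pr (Eq boole) (ff, (tru, tt)).

Definition Neg {D : list arity} {G : ctx} (A : fm [] G) : fm D G := Imp A Bot.

Definition Top {D : list arity} {G : ctx} : fm D G := Neg Bot.

Fixpoint Conj {D : list arity} {G : ctx} (As : list (fm D G)) : fm D G :=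
  match As with
  | [] => Top
  | [A] => A
  | A :: As' => And A (Conj As')
  end.

Fixpoint Disj {D : list arity} {G : ctx} (As : list (fm D G)) : fm D G :=
  match As with
  | [] => Bot
  | [A] => A
  | A :: As' => Or A (Disj As')
  end.

Fixpoint eqs {D : list arity} {G : ctx} {ar : list type}
  : tms G ar -> tms G ar -> list (fm D G) :=
  match ar with
  | [] => fun _ _ => []
  | r :: ar' => fun ts us =>
      Pr (Eq r) (fst ts, (fst us, tt)) :: eqs (snd ts) (snd us)
  end.

Definition Eqs {D : list arity} {G : ctx} {ar : list type} (ts us : tms G ar)
  : fm D G := Conj (eqs ts us).

(* y == t, for variables y of the types [ar] and terms t in variables [xs]. *)
Definition vars_eq {D : list arity} {xs : ctx} {ar : arity} (ts : tms xs ar)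
  : fm D (xs ++ ar) :=
  Eqs (tms_vars (fun _ => @mem_right _ xs _ _))
      (tms_sub (tsub_ren (fun _ => @mem_left _ _ _ _)) ts).

Definition Cap {D : list arity} {ar : arity} (P Q : pred D ar) : pred D ar :=
  Compr (And (Pr P (tms_vars (fun _ x => x))) (Pr Q (tms_vars (fun _ x => x)))).

Definition Cup {D : list arity} {ar : arity} (P Q : pred D ar) : pred D ar :=
  Compr (Or (Pr P (tms_vars (fun _ x => x))) (Pr Q (tms_vars (fun _ x => x)))).

Definition Incl {G : ctx} {ar : arity} (P Q : pred [] ar) : fm [] G :=
  Alls ar (Imp (Pr P (tms_vars (fun _ => @mem_left _ _ _ _)))
               (Pr Q (tms_vars (fun _ => @mem_left _ _ _ _)))).

(** * Strong negation *)

(* If X is bound by mu or nu, then it occurs only strictly positively in its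
   scope, so that strong negation replaces all its occurrences there by X';
   the negated operator binds X' and X' has the same de Bruijn index. *)
Fixpoint fm_sneg {D : list arity} {G : ctx} (A : fm D G) : fm D G :=
  match A in fm _ G return fm D G with
  | Pr P ts => Pr (pred_sneg P) ts
  | Imp A B => And (fm_open A) (fm_sneg B)
  | And A B => Or (fm_sneg A) (fm_sneg B)
  | Or A B => And (fm_sneg A) (fm_sneg B)
  | All A => Ex (fm_sneg A)
  | Ex A => All (fm_sneg A)
  end
with pred_sneg {D : list arity} {ar : arity} (P : pred D ar) : pred D ar :=
  match P in pred _ ar return pred D ar with
  | PVar X => PVar (prime X)
  | PBnd X => PBnd X
  | Compr A => Compr (fm_sneg A)
  | @Mu _ ar K =>
      Nu [ Cl (xs := ar) [ Conj (map clause_sneg K) ] (tms_vars (fun _ x => x)) ]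
  | @Nu _ ar K =>
      Mu [ Cl (xs := ar) [ Conj (map clause_sneg K) ] (tms_vars (fun _ x => x)) ]
  end
(* forall x_i (y == t_i -> B_i), with free variables y *)
with clause_sneg {D : list arity} {ar : arity} (c : clause D ar) : fm D ar :=
  match c in clause _ ar return fm D ar with
  | @Cl _ ar xs As ts =>
      Alls xs (Imp (vars_eq ts) (fm_left (Disj (map fm_sneg As))))
  end.

(** * Strictly positive free predicate variables *)

(* Bound predicate variables are not [PVar]s, so nothing has to be removed at
   [Mu] and [Nu]. *)
Fixpoint fm_PP {D : list arity} {G : ctx} (A : fm D G) : list pvar :=
  match A with
  | Pr P _ => pred_PP P
  | Imp _ B => fm_PP B
  | And A B | Or A B => fm_PP A ++ fm_PP B
  | All A | Ex A => fm_PP A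
  end
with pred_PP {D : list arity} {ar : arity} (P : pred D ar) : list pvar :=
  match P with
  | PVar X => [X]
  | PBnd _ => []
  | Compr A => fm_PP A
  | Mu K | Nu K => flat_map clause_PP K
  end
with clause_PP {D : list arity} {ar : arity} (c : clause D ar) : list pvar :=
  match c with
  | Cl As _ => flat_map fm_PP As
  end.

End Syntax.

Arguments tm C G _ : clear implicits.
Arguments tms C G ar : clear implicits.
Arguments tsub C G H : clear implicits.
Arguments rule C D : clear implicits.
Arguments fm C D _ : clear implicits.
Arguments pred C D _ : clear implicits.
Arguments clause C D _ : clear implicits.
Arguments Eq {C D} r.

(** * Computation *)

Record signature : Type := {
  sg_const :> constants;
  sg_rules : forall D : pconst sg_const, list (rule sg_const D);
  sg_ok : forall D, Forall rule_ok (@sg_rules D);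
  sg_non_unifiable : forall D, ForallOrdPairs non_unifiable (@sg_rules D)
}.

Arguments sg_rules : clear implicits.

Section Derivations.

Context {S : signature}.

Inductive tm_conv : forall G s, tm S G s -> tm S G s -> Prop :=
| tc_refl : forall G s (t : tm S G s), tm_conv t t
| tc_sym : forall G s (t u : tm S G s), tm_conv t u -> tm_conv u t
| tc_trans : forall G s (t u v : tm S G s),
    tm_conv t u -> tm_conv u v -> tm_conv t v
| tc_lam : forall G r s (t t' : tm S (r :: G) s),
    tm_conv t t' -> tm_conv (Lam t) (Lam t')
| tc_app : forall G r s (t t' : tm S G (Arr r s)) (u u' : tm S G r),
    tm_conv t t' -> tm_conv u u' -> tm_conv (App t u) (App t' u')
| tc_beta : forall G r s (t : tm S (r :: G) s) (u : tm S G r),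
    tm_conv (App (Lam t) u) (tm_sub (tsub_cons u (fun _ => @Var _ _ _)) t)
| tc_rule : forall G (D : pconst S) (R : rule S D) (f : tsub S (rl_ctx R) G),
    In R (sg_rules S D) ->
    tm_conv (apps (Prog D) (tms_sub f (rl_lhs R))) (tm_sub f (rl_rhs R)).

Fixpoint tms_conv {G : ctx} {ar : list type} : tms S G ar -> tms S G ar -> Prop :=
  match ar with
  | [] => fun _ _ => True
  | r :: ar' => fun ts us =>
      tm_conv (fst ts) (fst us) /\ tms_conv (snd ts) (snd us)
  end.

(* Identification of formulas induced by that of terms and by
   {x | A} t = A[x/t]. *)
Inductive fm_conv : forall D G, fm S D G -> fm S D G -> Prop :=
| fc_refl : forall D G (A : fm S D G), fm_conv A A
| fc_sym : forall D G (A B : fm S D G), fm_conv A B -> fm_conv B A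
| fc_trans : forall D G (A B A' : fm S D G),
    fm_conv A B -> fm_conv B A' -> fm_conv A A'
| fc_compr : forall D G ar (A : fm S D ar) (ts : tms S G ar),
    fm_conv (Pr (Compr A) ts) (fm_sub (tsub_of ts) A)
| fc_pr : forall D G ar (P P' : pred S D ar) (ts ts' : tms S G ar),
    pred_conv P P' -> tms_conv ts ts' -> fm_conv (Pr P ts) (Pr P' ts')
| fc_imp : forall D G (A A' : fm S [] G) (B B' : fm S D G),
    fm_conv A A' -> fm_conv B B' -> fm_conv (Imp A B) (Imp A' B')
| fc_and : forall D G (A A' B B' : fm S D G),
    fm_conv A A' -> fm_conv B B' -> fm_conv (And A B) (And A' B')
| fc_or : forall D G (A A' B B' : fm S D G),
    fm_conv A A' -> fm_conv B B' -> fm_conv (Or A B) (Or A' B')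
| fc_all : forall D G r (A A' : fm S D (r :: G)),
    fm_conv A A' -> fm_conv (All A) (All A')
| fc_ex : forall D G r (A A' : fm S D (r :: G)),
    fm_conv A A' -> fm_conv (Ex A) (Ex A')
with pred_conv : forall D ar, pred S D ar -> pred S D ar -> Prop :=
| pc_refl : forall D ar (P : pred S D ar), pred_conv P P
| pc_sym : forall D ar (P Q : pred S D ar), pred_conv P Q -> pred_conv Q P
| pc_trans : forall D ar (P Q P' : pred S D ar),
    pred_conv P Q -> pred_conv Q P' -> pred_conv P P'
| pc_compr : forall D ar (A A' : fm S D ar),
    fm_conv A A' -> pred_conv (Compr A) (Compr A')
| pc_mu : forall D ar (K K' : list (clause S (ar :: D) ar)),
    Forall2 (@clause_conv _ _) K K' -> pred_conv (Mu K) (Mu K')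
| pc_nu : forall D ar (K K' : list (clause S (ar :: D) ar)),
    Forall2 (@clause_conv _ _) K K' -> pred_conv (Nu K) (Nu K')
with clause_conv : forall D ar, clause S D ar -> clause S D ar -> Prop :=
| cc_cl : forall D ar xs (As As' : list (fm S D xs)) (ts ts' : tms S xs ar),
    Forall2 (@fm_conv _ _) As As' -> tms_conv ts ts' ->
    clause_conv (Cl As ts) (Cl As' ts').

(** * Derivations *)

(* forall x_i (A_i(P) -> Q t_i) *)
Definition clause_fm {G : ctx} {br ar : arity} (P : pred S [] br)
  (Q : pred S [] ar) (c : clause S [br] ar) : fm S [] G :=
  match c in clause _ _ ar return pred S [] ar -> fm S [] G with
  | @Cl _ _ ar xs As ts => fun Q =>
      Alls xs (fm_left (Imps (map (fm_pinst P) As) (Pr Q ts)))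
  end Q.

(* exists x_i (y == t_i /\ /\ A_i(P)), with free variables y *)
Definition clause_disjunct {br ar : arity} (P : pred S [] br)
  (c : clause S [br] ar) : fm S [] ar :=
  match c in clause _ _ ar return fm S [] ar with
  | @Cl _ _ ar xs As ts =>
      Exs xs (And (vars_eq ts) (fm_left (Conj (map (fm_pinst P) As))))
  end.

Definition Phi {ar : arity} (K : list (clause S [ar] ar)) (P : pred S [] ar)
  : pred S [] ar := Compr (Disj (map (clause_disjunct P) K)).

Inductive ax {G : ctx} : fm S [] G -> Prop :=
| ax_and_i : forall A B, ax (Imp A (Imp B (And A B)))
| ax_and_e : forall A B D, ax (Imp (And A B) (Imp (Imp A (Imp B D)) D))
| ax_or_l : forall A B, ax (Imp A (Or A B))
| ax_or_r : forall A B, ax (Imp B (Or A B))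
| ax_or_e : forall A B D,
    ax (Imp (Or A B) (Imp (Imp A D) (Imp (Imp B D) D)))
| ax_ex_i : forall r (A : fm S [] (r :: G)),
    ax (All (Imp A (fm_wk (Ex A))))
| ax_ex_e : forall r (A : fm S [] (r :: G)) (B : fm S [] G),
    ax (Imp (Ex A) (Imp (All (Imp A (fm_wk B))) B))
| ax_mu_i : forall ar (K : list (clause S [ar] ar)) c,
    In c K -> ax (clause_fm (Mu K) (Mu K) c)
| ax_mu_e : forall ar (K : list (clause S [ar] ar)) (P : pred S [] ar),
    ax (Imps (map (clause_fm (Cap (Mu K) P) P) K) (Incl (Mu K) P))
| ax_nu_e : forall ar (K : list (clause S [ar] ar)),
    ax (Incl (Nu K) (Phi K (Nu K)))
| ax_nu_i : forall ar (K : list (clause S [ar] ar)) (Q : pred S [] ar),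
    ax (Imp (Incl Q (Phi K (Cup (Nu K) Q))) (Incl Q (Nu K))).

(* [derivable H A]: the formula A is derivable from assumptions in H, all with
   free term variables in G.  [d_var] expresses that there are term variables of
   every type, also if G does not contain them. *)
Inductive derivable : forall G, list (fm S [] G) -> fm S [] G -> Prop :=
| d_ass : forall G (H : list (fm S [] G)) A, In A H -> derivable H A
| d_ax : forall G (H : list (fm S [] G)) A, ax A -> derivable H A
| d_conv : forall G (H : list (fm S [] G)) A B,
    fm_conv A B -> derivable H A -> derivable H B
| d_imp_i : forall G (H : list (fm S [] G)) A B,
    derivable (A :: H) B -> derivable H (Imp A B)
| d_imp_e : forall G (H : list (fm S [] G)) A B,
    derivable H (Imp A B) -> derivable H A -> derivable H B
| d_all_i : forall G (H : list (fm S [] G)) r (A : fm S [] (r :: G)),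
    derivable (map (@fm_wk _ _ _ r) H) A -> derivable H (All A)
| d_all_e : forall G (H : list (fm S [] G)) r (A : fm S [] (r :: G)) t,
    derivable H (All A) -> derivable H (fm_inst A t)
| d_var : forall G (H : list (fm S [] G)) r A,
    derivable (map (@fm_wk _ _ _ r) H) (fm_wk A) -> derivable H A.

(* The universal closure of ~~B -> B, as a formula in any context. *)
Definition Stab {G : ctx} (B : {xs : ctx & fm S [] xs}) : fm S [] G :=
  Alls (projT1 B) (fm_left (Imp (Neg (Neg (projT2 B))) (projT2 B))).

Definition derivable_c {G : ctx} (H : list (fm S [] G)) (A : fm S [] G) : Prop :=
  exists Bs : list {xs : ctx & fm S [] xs}, derivable (H ++ map Stab Bs) A.

(* forall x (~ Y x -> Y' x) *)
Definition neg_to_prime {G : ctx} (Y : pvar) : fm S [] G :=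
  let ys := tms_vars (fun _ => @mem_left _ _ _ _) in
  Alls (pv_arity Y) (Imp (Neg (Pr (PVar Y) ys)) (Pr (PVar (prime Y)) ys)).

End Derivations.

(* Main.v *)
Require Import Defs.
From Stdlib Require Import List FunctionalExtensionality.
Import ListNotations.

(** Classically, [~A -> A^N] is an induction on [A]: strong negation pushes the
    negation through the connectives by the de Morgan laws, and at a free
    predicate variable [Y] in strictly positive position the inclusion of the
    complement of [Y] in [Y'] is assumed.  To the left of an implication nothing
    is negated: classically, [~(A -> B)] amounts to [A /\ ~B].

    The work lies in the fixed points.  Since the bound variable occurs only
    strictly positively, the induction is carried out for formulas with bound
    predicate variables [X], into which predicates [f X] and [g X] are
    substituted on the two sides, under the hypothesis that the complement of
    [f X] is included in [g X] ([neg_incl], [neg_sneg_fm]).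
    - Let [M] be the least fixed point of the clauses [K] and [N] its strong
      negation, a greatest fixed point.  By coinduction for [N] with competitor
      [Q], the complement of [M], let [y] be outside [M].  If [y == t] for a
      clause with conclusion [X t], then the premises of that clause cannot all
      hold for [M], since otherwise [M t], hence [M y].  So one of them fails
      for [M], and by the induction hypothesis, with [X] replaced by [M] on the
      left and by the union of [N] and [Q] on the right, its strong negation
      holds.  See [neg_sneg_mu].
    - Let [N] be the greatest fixed point of [K] and [M] its strong negation, a
      least fixed point.  Contrapositively, the complement [Q] of [M] is
      included in [N], by coinduction for [N].  If [Q y] and no clause of [K]
      yields [y] from the union of [N] and [Q], then for each clause with
      [y == t] a premise fails for this union, whose complement is included in
      [M]; so the strong negation of that premise holds for [M], and [M y] by
      the clause of [M].  See [neg_sneg_nu].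
    Both cases share [fixed_point_step].

    Formally, the object-level derivations are replaced by reasoning about the
    relation [derivable_c Hs A]: it is closed under the rules of natural
    deduction, under the stability rule [c_stab], and under substitution of
    terms ([c_sub]).  The latter permits to read implications and universal
    quantifiers as in Kripke semantics, a world being a context [G] with a list
    [Hs] of hypotheses and an extension being a substitution that maps the
    hypotheses into those of the new world ([extends]). *)

Set Implicit Arguments.

(** * Substitution of terms *)

(** The dependent elimination of [mem (b :: l) a], spelled out with a return
    type by cases on the list so that no axiom about equality is needed. *)
Lemma mem_cons_case (A : Type) (b : A) (l : list A)
  (P : forall a, mem (b :: l) a -> Prop) :
  P b mz -> (forall a m, P a (ms m)) -> forall a m, P a m.
Proof.
  intros Hz Hs a m.
  refine ((match m in mem k a
    return match k return mem k a -> Type with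
           | [] => fun _ => unit
           | b :: l => fun m => forall P : (forall a, mem (b :: l) a -> Prop),
               P b mz -> (forall a m, P a (ms m)) -> P a m
           end m
  with mz => fun P h _ => h | ms m => fun P _ h => h _ m end) P Hz Hs).
Qed.

Lemma mem_fun_ext (A : Type) (B : A -> Type) (l : list A)
  (f g : forall a, mem l a -> B a) : (forall a m, f a m = g a m) -> f = g.
Proof.
  intro E. do 2 (apply functional_extensionality_dep; intro). apply E.
Qed.

Lemma mem_fun_cons (A : Type) (B : A -> Type) (b : A) (l : list A)
  (f g : forall a, mem (b :: l) a -> B a) :
  f b mz = g b mz -> (forall a m, f a (ms m) = g a (ms m)) -> f = g.
Proof.
  intros Ez Es. apply mem_fun_ext. now apply mem_cons_case.
Qed.

Lemma mem_fun_nil (A : Type) (B : A -> Type) (f g : forall a, mem [] a -> B a) :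
  f = g.
Proof. apply mem_fun_ext. intros a m. exact (mem_nil m). Qed.

Section Syntax.

Context {C : constants}.

Lemma tm_ren_ren (G : ctx) s (t : tm C G s) :
  forall H K (f : forall r, mem G r -> mem H r)
    (g : forall r, mem H r -> mem K r),
  tm_ren g (tm_ren f t) = tm_ren (fun r x => g r (f r x)) t.
Proof.
  induction t; intros; cbn; auto.
  - f_equal. rewrite IHt. f_equal. now apply mem_fun_cons.
  - now rewrite IHt1, IHt2.
Qed.

Lemma tm_sub_ren (G : ctx) s (t : tm C G s) :
  forall H K (f : forall r, mem G r -> mem H r) (g : tsub C H K),
  tm_sub g (tm_ren f t) = tm_sub (fun r x => g r (f r x)) t.
Proof.
  induction t; intros; cbn; auto.
  - f_equal. rewrite IHt. f_equal. now apply mem_fun_cons.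
  - now rewrite IHt1, IHt2.
Qed.

Lemma tm_ren_sub (G : ctx) s (t : tm C G s) :
  forall H K (f : tsub C G H) (g : forall r, mem H r -> mem K r),
  tm_ren g (tm_sub f t) = tm_sub (fun r x => tm_ren g (f r x)) t.
Proof.
  induction t; intros; cbn; auto.
  - f_equal. rewrite IHt. f_equal. apply mem_fun_cons; auto.
    intros; cbn. now rewrite !tm_ren_ren.
  - now rewrite IHt1, IHt2.
Qed.

Definition tsub_comp {G H K : ctx} (f : tsub C G H) (g : tsub C H K)
  : tsub C G K := fun r x => tm_sub g (f r x).
Arguments tsub_comp {G H K} f g r x.

Definition tsub_id {G : ctx} : tsub C G G := fun r x => Var x.
Arguments tsub_id {G} r x.

Lemma tsub_lift_comp (G H K : ctx) (f : tsub C G H) (g : tsub C H K) r :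
  tsub_comp (tsub_lift (s := r) f) (tsub_lift g) = tsub_lift (tsub_comp f g).
Proof.
  apply mem_fun_cons; auto.
  intros; cbn. unfold tsub_comp; cbn. now rewrite tm_sub_ren, tm_ren_sub.
Qed.

Lemma tm_sub_sub (G : ctx) s (t : tm C G s) :
  forall H K (f : tsub C G H) (g : tsub C H K),
  tm_sub g (tm_sub f t) = tm_sub (tsub_comp f g) t.
Proof.
  induction t; intros; cbn; auto.
  - f_equal. now rewrite IHt, tsub_lift_comp.
  - now rewrite IHt1, IHt2.
Qed.

Lemma tsub_lift_id (G : ctx) r : tsub_lift (s := r) (@tsub_id G) = tsub_id.
Proof. now apply mem_fun_cons. Qed.

Lemma tm_sub_id (G : ctx) s (t : tm C G s) : tm_sub tsub_id t = t.
Proof.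
  induction t; cbn; auto.
  - f_equal. now rewrite tsub_lift_id.
  - now rewrite IHt1, IHt2.
Qed.

Lemma tsub_comp_id (G H : ctx) (f : tsub C G H) : tsub_comp f tsub_id = f.
Proof. apply mem_fun_ext. intros. apply tm_sub_id. Qed.

Lemma tm_sub_tsub_ren (G H : ctx) (g : forall r, mem G r -> mem H r) s
  (t : tm C G s) : tm_sub (tsub_ren g) t = tm_ren g t.
Proof. now rewrite <- (tm_sub_id (tm_ren g t)), tm_sub_ren. Qed.

Lemma tms_sub_sub (G H K : ctx) (f : tsub C G H) (g : tsub C H K) ar
  (ts : tms C G ar) : tms_sub g (tms_sub f ts) = tms_sub (tsub_comp f g) ts.
Proof.
  induction ar; cbn in *; auto. now rewrite IHar, tm_sub_sub.
Qed.

Lemma tms_sub_id (G : ctx) ar (ts : tms C G ar) : tms_sub tsub_id ts = ts.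
Proof.
  induction ar; cbn in *; destruct ts; auto. cbn. now rewrite IHar, tm_sub_id.
Qed.

Lemma tms_sub_vars (G H : ctx) (f : tsub C G H) ar :
  forall x : (forall r, mem ar r -> mem G r),
  tms_sub f (tms_vars x) =
  tms_sub (fun r m => f r (x r m)) (tms_vars (fun _ m => m)).
Proof.
  revert G f; induction ar; intros; cbn; auto.
  f_equal. rewrite IHar. symmetry. now rewrite IHar.
Qed.

Lemma tms_ren_vars (G H : ctx) (g : forall r, mem G r -> mem H r) ar :
  forall x : (forall r, mem ar r -> mem G r),
  tms_sub (tsub_ren g) (tms_vars (C := C) x) =
  tms_vars (fun r m => g r (x r m)).
Proof.
  induction ar; intros; cbn; auto. now rewrite IHar.
Qed.

Lemma tm_sub_apps (G H : ctx) (f : tsub C G H) rs s :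
  forall (t : tm C G (arrs rs s)) us,
  tm_sub f (apps t us) = apps (tm_sub f t) (tms_sub f us).
Proof.
  induction rs; intros; cbn in *; auto.
Qed.

(** Substitutes [ts] for the first block of variables and acts as [f] on the
    rest, as needed to instantiate the quantifier blocks [Alls] and [Exs]. *)
Fixpoint tsub_app {G H : ctx} {xs : list type}
  : tms C H xs -> tsub C G H -> tsub C (xs ++ G) H :=
  match xs with
  | [] => fun _ f => f
  | r :: xs' => fun ts f => tsub_cons (fst ts) (tsub_app (snd ts) f)
  end.
Arguments tsub_app {G H xs} ts f r x.

Lemma tsub_cons_comp (G H K : ctx) r (t : tm C H r) (f : tsub C G H)
  (g : tsub C H K) :
  tsub_comp (tsub_cons t f) g = tsub_cons (tm_sub g t) (tsub_comp f g).
Proof. now apply mem_fun_cons. Qed.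

Lemma tsub_lift_cons (G H K : ctx) r (f : tsub C G H) (t : tm C K r)
  (g : tsub C H K) :
  tsub_comp (tsub_lift f) (tsub_cons t g) = tsub_cons t (tsub_comp f g).
Proof.
  apply mem_fun_cons; auto. intros; cbn. unfold tsub_comp; cbn.
  now rewrite tm_sub_ren.
Qed.

Lemma tsub_app_comp (G H K : ctx) xs (ts : tms C H xs) (f : tsub C G H)
  (g : tsub C H K) :
  tsub_comp (tsub_app ts f) g = tsub_app (tms_sub g ts) (tsub_comp f g).
Proof.
  induction xs; cbn in *; auto. now rewrite tsub_cons_comp, IHxs.
Qed.

Lemma tsub_app_right (G H : ctx) xs (ts : tms C H xs) (f : tsub C G H) r
  (x : mem G r) : tsub_app ts f _ (mem_right xs x) = f r x.
Proof. induction xs; cbn in *; auto. Qed.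

Lemma tsub_app_left (G H : ctx) xs (ts : tms C H xs) (f : tsub C G H) :
  forall r (x : mem xs r), tsub_app ts f _ (mem_left x) = tsub_of ts x.
Proof.
  induction xs; cbn in *; intros; [exact (mem_nil x)|].
  revert r x. apply mem_cons_case; cbn; auto.
Qed.

Lemma tsub_of_comp (H K : ctx) xs (ts : tms C H xs) (g : tsub C H K) :
  tsub_comp (tsub_of ts) g = tsub_of (tms_sub g ts).
Proof.
  induction xs; cbn in *; [apply mem_fun_nil|].
  now rewrite tsub_cons_comp, IHxs.
Qed.

Lemma tms_sub_of_vars (H : ctx) xs (ts : tms C H xs) :
  tms_sub (tsub_of ts) (tms_vars (fun _ m => m)) = ts.
Proof.
  induction xs; cbn in *; destruct ts; auto. cbn. rewrite tms_sub_vars. cbn.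
  f_equal. apply IHxs.
Qed.

Lemma tsub_of_vars (G : ctx) xs (x : forall r, mem xs r -> mem G r) :
  tsub_of (tms_vars (C := C) x) = fun r m => Var (x r m).
Proof.
  revert G x; induction xs; intros; cbn; [apply mem_fun_nil|].
  apply mem_fun_cons; auto. intros; cbn. now rewrite IHxs.
Qed.

Lemma tsub_of_id (xs : ctx) :
  tsub_of (tms_vars (C := C) (fun _ x => x)) = @tsub_id xs.
Proof. apply tsub_of_vars. Qed.

Lemma tsub_app_vars (G : ctx) xs :
  tsub_app (tms_vars (fun _ => @mem_left _ _ G _))
    (tsub_ren (fun _ => @mem_right _ xs G _)) = @tsub_id (xs ++ G).
Proof.
  induction xs; cbn; auto. apply mem_fun_cons; auto. intros; cbn.
  set (f := tsub_app _ _).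
  (* Up to conversion, [f] is the identity composed with the weakening by [a],
     to which the induction hypothesis applies. *)
  enough (f = fun r x => Var (ms x)) as -> by reflexivity. subst f.
  transitivity
    (tsub_comp (@tsub_id (xs ++ G)) (tsub_ren (fun _ => @ms _ _ a _)));
    [|reflexivity].
  rewrite <- IHxs, tsub_app_comp. f_equal.
  now rewrite tms_ren_vars.
Qed.

Lemma fm_sub_sub D (G : ctx) (A : fm C D G) :
  forall H K (f : tsub C G H) (g : tsub C H K),
  fm_sub g (fm_sub f A) = fm_sub (tsub_comp f g) A.
Proof.
  induction A; intros; cbn; rewrite ?tms_sub_sub, ?IHA, ?IHA1, ?IHA2,
    ?tsub_lift_comp; auto.
Qed.

Lemma fm_sub_id D (G : ctx) (A : fm C D G) : fm_sub tsub_id A = A.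
Proof.
  induction A; intros; cbn; rewrite ?tms_sub_id, ?tsub_lift_id, ?IHA,
    ?IHA1, ?IHA2; auto.
Qed.

End Syntax.

(** * Substitution of predicates *)

Section FormulaInduction.

Context {C : constants}.
Context (P : forall D G, fm C D G -> Prop).
Context (Q : forall D ar, pred C D ar -> Prop).

(** The nesting of formulas in lists in clauses hides these induction
    hypotheses from the automatically generated induction principles. *)
Definition on_premises {D ar} (c : clause C D ar) : Prop :=
  match c with Cl As _ => Forall (@P _ _) As end.

Context (P_pr : forall D G ar (p : pred C D ar) (ts : tms C G ar),
  Q p -> P (Pr p ts)).
Context (P_imp : forall D G (A : fm C [] G) (B : fm C D G),
  P A -> P B -> P (Imp A B)).
Context (P_and : forall D G (A B : fm C D G), P A -> P B -> P (And A B)).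
Context (P_or : forall D G (A B : fm C D G), P A -> P B -> P (Or A B)).
Context (P_all : forall D G r (A : fm C D (r :: G)), P A -> P (All A)).
Context (P_ex : forall D G r (A : fm C D (r :: G)), P A -> P (Ex A)).
Context (Q_var : forall D X, Q (@PVar C D X)).
Context (Q_bnd : forall D ar (X : mem D ar), Q (PBnd X)).
Context (Q_compr : forall D ar (A : fm C D ar), P A -> Q (Compr A)).
Context (Q_mu : forall D ar (K : list (clause C (ar :: D) ar)),
  Forall on_premises K -> Q (Mu K)).
Context (Q_nu : forall D ar (K : list (clause C (ar :: D) ar)),
  Forall on_premises K -> Q (Nu K)).

Fixpoint fm_pred_ind D G (A : fm C D G) : P A :=
  match A with
  | Pr p ts => @P_pr _ _ _ _ ts (pred_fm_ind p)
  | Imp A B => @P_imp _ _ _ _ (fm_pred_ind A) (fm_pred_ind B)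
  | And A B => @P_and _ _ _ _ (fm_pred_ind A) (fm_pred_ind B)
  | Or A B => @P_or _ _ _ _ (fm_pred_ind A) (fm_pred_ind B)
  | All A => @P_all _ _ _ _ (fm_pred_ind A)
  | Ex A => @P_ex _ _ _ _ (fm_pred_ind A)
  end
with pred_fm_ind D ar (p : pred C D ar) : Q p :=
  match p with
  | PVar X => Q_var _ X
  | PBnd X => @Q_bnd _ _ X
  | Compr A => @Q_compr _ _ _ (fm_pred_ind A)
  | Mu K => @Q_mu _ _ _
      ((fix go K : Forall on_premises K :=
        match K with
        | [] => Forall_nil _
        | c :: K => Forall_cons c (clause_fm_ind c) (go K)
        end) K)
  | Nu K => @Q_nu _ _ _
      ((fix go K : Forall on_premises K :=
        match K with
        | [] => Forall_nil _
        | c :: K => Forall_cons c (clause_fm_ind c) (go K)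
        end) K)
  end
with clause_fm_ind D ar (c : clause C D ar) : on_premises c :=
  match c with
  | Cl As _ =>
      (fix go As : Forall (@P _ _) As :=
        match As with
        | [] => Forall_nil _
        | A :: As => Forall_cons A (fm_pred_ind A) (go As)
        end) As
  end.

Lemma fm_pred_mutind :
  (forall D G (A : fm C D G), P A) /\ (forall D ar (p : pred C D ar), Q p).
Proof. split; [exact fm_pred_ind|exact pred_fm_ind]. Qed.

End FormulaInduction.

Section PredicateSubstitution.

Context {C : constants}.

Lemma lift_ren_comp (A : Type) (k l m : list A) b
  (f : forall a, mem k a -> mem l a) (g : forall a, mem l a -> mem m a) :
  (fun a x => lift_ren g (lift_ren (b := b) f x)) =
  lift_ren (fun a x => g a (f a x)).
Proof. now apply mem_fun_cons. Qed.

(** The form in which the induction hypotheses for the premises of the clauses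
    enter a proof of an equation between fixed points. *)
Lemma map_clauses_ext D E ar (P : forall D G, fm C D G -> Prop)
  (f g : clause C D ar -> clause C E ar) K :
  Forall (on_premises P) K -> (forall c, on_premises P c -> f c = g c) ->
  map f K = map g K.
Proof.
  intros HK E'. apply map_ext_Forall. revert HK. apply Forall_impl. exact E'.
Qed.

Ltac psub_induction :=
  apply fm_pred_mutind; intros; cbn; f_equal; auto;
  try (rewrite map_map; eapply map_clauses_ext; [eassumption|];
    clear; intros c Hc; destruct c; cbn in *; f_equal; rewrite ?map_map;
    apply map_ext_Forall; revert Hc; apply Forall_impl; intros A HA).

Lemma pren_pren :
  (forall D G (A : fm C D G) E F (f : pren D E) (g : pren E F),
    fm_pren g (fm_pren f A) = fm_pren (fun _ X => g _ (f _ X)) A) /\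
  (forall D ar (P : pred C D ar) E F (f : pren D E) (g : pren E F),
    pred_pren g (pred_pren f P) = pred_pren (fun _ X => g _ (f _ X)) P).
Proof.
  psub_induction; rewrite HA; now rewrite lift_ren_comp.
Qed.

Lemma psub_lift_ren D E F ar (f : pren D E) (g : @psub C E F) :
  (fun a X => psub_lift g (lift_ren (b := ar) f X)) =
  psub_lift (fun a X => g a (f a X)).
Proof. now apply mem_fun_cons. Qed.

Lemma psub_pren :
  (forall D G (A : fm C D G) E F (f : pren D E) (g : @psub C E F),
    fm_psub g (fm_pren f A) = fm_psub (fun _ X => g _ (f _ X)) A) /\
  (forall D ar (P : pred C D ar) E F (f : pren D E) (g : @psub C E F),
    pred_psub g (pred_pren f P) = pred_psub (fun _ X => g _ (f _ X)) P).
Proof.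
  psub_induction; rewrite HA; now rewrite psub_lift_ren.
Qed.

Lemma pren_psub_lift D E F ar (f : @psub C D E) (g : pren E F) :
  (fun a X => pred_pren (lift_ren (b := ar) g) (psub_lift f X)) =
  psub_lift (fun a X => pred_pren g (f a X)).
Proof.
  apply mem_fun_cons; auto. intros; cbn. now rewrite !(proj2 pren_pren).
Qed.

Lemma pren_psub :
  (forall D G (A : fm C D G) E F (f : @psub C D E) (g : pren E F),
    fm_pren g (fm_psub f A) = fm_psub (fun _ X => pred_pren g (f _ X)) A) /\
  (forall D ar (P : pred C D ar) E F (f : @psub C D E) (g : pren E F),
    pred_pren g (pred_psub f P) = pred_psub (fun _ X => pred_pren g (f _ X)) P).
Proof.
  psub_induction; rewrite HA; now rewrite pren_psub_lift.
Qed.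

Lemma psub_lift_comp D E F ar (f : @psub C D E) (g : @psub C E F) :
  (fun a X => pred_psub (psub_lift (ar := ar) g) (psub_lift f X)) =
  psub_lift (fun a X => pred_psub g (f a X)).
Proof.
  apply mem_fun_cons; auto. intros; cbn.
  now rewrite (proj2 psub_pren), (proj2 pren_psub).
Qed.

Lemma psub_psub :
  (forall D G (A : fm C D G) E F (f : @psub C D E) (g : @psub C E F),
    fm_psub g (fm_psub f A) = fm_psub (fun _ X => pred_psub g (f _ X)) A) /\
  (forall D ar (P : pred C D ar) E F (f : @psub C D E) (g : @psub C E F),
    pred_psub g (pred_psub f P) = pred_psub (fun _ X => pred_psub g (f _ X)) P).
Proof.
  psub_induction; rewrite HA; now rewrite psub_lift_comp.
Qed.

Lemma psub_lift_id D ar :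
  psub_lift (fun _ X => PBnd X) = (fun _ X => PBnd X : pred C (ar :: D) _).
Proof. now apply mem_fun_cons. Qed.

Lemma psub_id :
  (forall D G (A : fm C D G), fm_psub (fun _ X => PBnd X) A = A) /\
  (forall D ar (P : pred C D ar), pred_psub (fun _ X => PBnd X) P = P).
Proof.
  apply fm_pred_mutind; intros; cbn; f_equal; auto;
    rewrite <- map_id; eapply map_clauses_ext; try eassumption;
    intros c Hc; destruct c; cbn in *; f_equal; rewrite <- map_id;
    apply map_ext_Forall; revert Hc; apply Forall_impl; intros A HA;
    now rewrite psub_lift_id.
Qed.

(** An eliminator for clauses [c] whose arity also occurs in the context of
    predicate variables, where [destruct c] is ill-typed. *)
Lemma clause_cl D ar (c : clause C D ar) :
  exists xs As (ts : tms C xs ar), c = Cl As ts.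
Proof. destruct c; eauto. Qed.

Lemma in_clause_psub D E (f : @psub C D E) ar K xs As (ts : tms C xs ar) :
  In (Cl As ts) K -> In (Cl (map (fm_psub f) As) ts) (map (clause_psub f) K).
Proof. apply (in_map (clause_psub f)). Qed.

(** In the case of an implication, its left-hand side and that side's copy in the
    strong negation thereby become the same formula. *)
Lemma psub_open D G (f : @psub C D []) (A : fm C [] G) :
  fm_psub f (fm_open A) = A.
Proof.
  unfold fm_open. rewrite (proj1 psub_pren).
  rewrite <- (proj1 psub_id _ _ A) at 2. f_equal. apply mem_fun_nil.
Qed.

(** The axioms for a substituted fixed point mention [fm_pinst] of premises
    substituted under the binder; this brings them to the form of the induction
    hypothesis, a single substitution into the original premise. *)
Lemma pinst_psub_lift D ar G (P : pred C [] ar) (f : @psub C D [])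
  (A : fm C (ar :: D) G) :
  fm_pinst P (fm_psub (psub_lift f) A) = fm_psub (psub_cons P f) A.
Proof.
  unfold fm_pinst. rewrite (proj1 psub_psub). f_equal.
  apply mem_fun_cons; auto. intros; cbn.
  rewrite (proj2 psub_pren). apply psub_id.
Qed.

Lemma fm_psub_sub D E (f : @psub C D E) G (A : fm C D G) :
  forall H (s : tsub C G H), fm_psub f (fm_sub s A) = fm_sub s (fm_psub f A).
Proof.
  induction A; intros; cbn; f_equal; auto.
Qed.

Lemma fm_psub_Alls D E (f : @psub C D E) xs : forall G (A : fm C D (xs ++ G)),
  fm_psub f (Alls xs A) = Alls xs (fm_psub f A).
Proof. induction xs; intros; cbn; auto. Qed.

Lemma fm_psub_Conj D E (f : @psub C D E) G (As : list (fm C D G)) :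
  fm_psub f (Conj As) = Conj (map (fm_psub f) As).
Proof.
  induction As as [|A [|B As]]; auto. cbn in *. now f_equal.
Qed.

Lemma fm_psub_Disj D E (f : @psub C D E) G (As : list (fm C D G)) :
  fm_psub f (Disj As) = Disj (map (fm_psub f) As).
Proof.
  induction As as [|A [|B As]]; auto. cbn in *. now f_equal.
Qed.

Lemma fm_sub_Conj D G H (f : tsub C G H) (As : list (fm C D G)) :
  fm_sub f (Conj As) = Conj (map (fm_sub f) As).
Proof.
  induction As as [|A [|B As]]; auto. cbn in *. now f_equal.
Qed.

Lemma fm_sub_Disj D G H (f : tsub C G H) (As : list (fm C D G)) :
  fm_sub f (Disj As) = Disj (map (fm_sub f) As).
Proof.
  induction As as [|A [|B As]]; auto. cbn in *. now f_equal.
Qed.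

Lemma fm_sub_Imps G H (f : tsub C G H) (As : list (fm C [] G)) B :
  fm_sub f (Imps As B) = Imps (map (fm_sub f) As) (fm_sub f B).
Proof. induction As; cbn; auto. now f_equal. Qed.

Lemma fm_sub_Eqs D G H (f : tsub C G H) ar (ts us : tms C G ar) :
  fm_sub f (Eqs ts us : fm C D G) = Eqs (tms_sub f ts) (tms_sub f us).
Proof.
  unfold Eqs. rewrite fm_sub_Conj. f_equal.
  induction ar; cbn; auto. now f_equal.
Qed.

Fixpoint tsub_lifts {G H : ctx} (xs : list type) (f : tsub C G H)
  : tsub C (xs ++ G) (xs ++ H) :=
  match xs with
  | [] => f
  | r :: xs' => tsub_lift (tsub_lifts xs' f)
  end.
Arguments tsub_lifts {G H} xs f r x.

Lemma fm_sub_Alls D G H (f : tsub C G H) xs : forall (A : fm C D (xs ++ G)),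
  fm_sub f (Alls xs A) = Alls xs (fm_sub (tsub_lifts xs f) A).
Proof. induction xs; intros; cbn; auto. Qed.

Lemma tsub_lifts_left G H (f : tsub C G H) xs :
  forall r (x : mem xs r), tsub_lifts xs f _ (mem_left x) = Var (mem_left x).
Proof.
  induction xs; cbn; intros; [exact (mem_nil x)|].
  revert r x. apply mem_cons_case; cbn; auto. intros. now rewrite IHxs.
Qed.

Lemma tsub_lifts_app G H K (f : tsub C G H) xs (ts : tms C K xs)
  (g : tsub C H K) :
  tsub_comp (tsub_lifts xs f) (tsub_app ts g) = tsub_app ts (tsub_comp f g).
Proof. induction xs; cbn in *; auto. now rewrite tsub_lift_cons, IHxs. Qed.

Lemma fm_sub_lifts_left D G H (f : tsub C G H) xs (A : fm C D xs) :
  fm_sub (tsub_lifts xs f) (fm_left A) = fm_left A.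
Proof.
  unfold fm_left, fm_ren. rewrite fm_sub_sub. f_equal.
  apply mem_fun_ext. intros; apply tsub_lifts_left.
Qed.

Lemma fm_sub_Exs D G H (f : tsub C G H) xs : forall (A : fm C D (xs ++ G)),
  fm_sub f (Exs xs A) = Exs xs (fm_sub (tsub_lifts xs f) A).
Proof. induction xs; intros; cbn; auto. Qed.

Lemma fm_sub_Alls_left D G H (f : tsub C G H) xs (A : fm C D xs) :
  fm_sub f (Alls xs (fm_left A)) = Alls xs (fm_left A).
Proof. now rewrite fm_sub_Alls, fm_sub_lifts_left. Qed.

Lemma fm_sub_app_left D G H xs (ts : tms C H xs) (f : tsub C G H)
  (A : fm C D xs) : fm_sub (tsub_app ts f) (fm_left A) = fm_sub (tsub_of ts) A.
Proof.
  unfold fm_left, fm_ren. rewrite fm_sub_sub. f_equal.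
  apply mem_fun_ext. intros; apply tsub_app_left.
Qed.

Lemma Incl_left G ar (P Q : pred C [] ar) :
  Incl P Q = Alls ar (fm_left (Imp (Pr P (tms_vars (fun _ x => x)))
    (Pr Q (tms_vars (fun _ x => x))))) :> fm C [] G.
Proof. unfold Incl, fm_left, fm_ren. cbn. now rewrite !tms_ren_vars. Qed.

Lemma fm_sub_app_vars_eq D H ar xs (ts : tms C xs ar) (vs : tms C H xs)
  (us : tms C H ar) :
  fm_sub (tsub_app vs (tsub_of us)) (vars_eq ts) =
  Eqs us (tms_sub (tsub_of vs) ts) :> fm C D H.
Proof.
  unfold vars_eq. rewrite fm_sub_Eqs, tms_sub_vars, tms_sub_sub. f_equal.
  - rewrite <- tms_sub_of_vars. f_equal. apply mem_fun_ext. intros.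
    apply tsub_app_right.
  - f_equal. apply mem_fun_ext. intros; apply tsub_app_left.
Qed.

End PredicateSubstitution.

(** * Derivability under substitution *)

Section Derivations.

Context {S : signature}.

(** Shows that the assumptions of the theorem are closed, so that they hold in
    all extensions. *)
Lemma neg_to_prime_left G (Y : pvar) :
  neg_to_prime Y = Alls (pv_arity Y) (fm_left (Imp
    (Neg (Pr (PVar Y) (tms_vars (fun _ x => x))))
    (Pr (PVar (prime Y)) (tms_vars (fun _ x => x))))) :> fm S [] G.
Proof.
  unfold neg_to_prime, fm_left, fm_ren. cbn. now rewrite !tms_ren_vars.
Qed.

Lemma tm_conv_sub G s (t u : tm S G s) : tm_conv t u ->
  forall H (f : tsub S G H), tm_conv (tm_sub f t) (tm_sub f u).
Proof.
  induction 1; intros; cbn.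
  - apply tc_refl.
  - now apply tc_sym.
  - eapply tc_trans; eauto.
  - now apply tc_lam.
  - now apply tc_app.
  - rewrite tm_sub_sub.
    replace (tsub_comp (tsub_cons u (fun _ => @Var _ _ _)) f)
      with (tsub_comp (tsub_lift f) (tsub_cons (tm_sub f u) tsub_id)).
    + rewrite <- tm_sub_sub. apply tc_beta.
    + rewrite tsub_lift_cons, tsub_cons_comp. f_equal.
      apply mem_fun_ext. intros. apply tm_sub_id.
  - rewrite tm_sub_apps, tms_sub_sub, tm_sub_sub. now apply tc_rule.
Qed.

Lemma tms_conv_sub G H (f : tsub S G H) ar (ts us : tms S G ar) :
  tms_conv ts us -> tms_conv (tms_sub f ts) (tms_sub f us).
Proof.
  induction ar; cbn in *; auto. intros []. split; auto. now apply tm_conv_sub.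
Qed.

Lemma fm_conv_sub D G (A B : fm S D G) : fm_conv A B ->
  forall H (f : tsub S G H), fm_conv (fm_sub f A) (fm_sub f B).
Proof.
  induction 1; intros; cbn.
  - apply fc_refl.
  - now apply fc_sym.
  - eapply fc_trans; eauto.
  - rewrite fm_sub_sub, tsub_of_comp. apply fc_compr.
  - apply fc_pr; auto. now apply tms_conv_sub.
  - now apply fc_imp.
  - now apply fc_and.
  - now apply fc_or.
  - now apply fc_all.
  - now apply fc_ex.
Qed.

Lemma fm_sub_clause_fm G H (f : tsub S G H) br ar (P : pred S [] br)
  (Q : pred S [] ar) c : fm_sub f (clause_fm P Q c) = clause_fm P Q c.
Proof. destruct c. apply fm_sub_Alls_left. Qed.

Lemma fm_sub_Incl G H (f : tsub S G H) ar (P Q : pred S [] ar) :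
  fm_sub f (Incl P Q) = Incl P Q.
Proof. rewrite !Incl_left. apply fm_sub_Alls_left. Qed.

Lemma fm_sub_Stab G H (f : tsub S G H) B : fm_sub f (Stab B) = Stab B.
Proof. apply fm_sub_Alls_left. Qed.

Lemma fm_sub_wk D G H r (f : tsub S G H) (A : fm S D G) :
  fm_sub (tsub_lift f) (fm_wk A) = fm_wk (r := r) (fm_sub f A).
Proof.
  unfold fm_wk, fm_ren. rewrite !fm_sub_sub. f_equal. apply mem_fun_ext.
  intros. unfold tsub_comp; cbn. now rewrite tm_sub_tsub_ren.
Qed.

Lemma fm_inst_wk D G r (A : fm S D G) (t : tm S G r) : fm_inst (fm_wk A) t = A.
Proof.
  unfold fm_inst, fm_wk, fm_ren. rewrite fm_sub_sub. apply fm_sub_id.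
Qed.

Lemma fm_inst_lift D G H r (f : tsub S G H) (A : fm S D (r :: G)) t :
  fm_inst (fm_sub (tsub_lift f) A) t = fm_sub (tsub_cons t f) A.
Proof.
  unfold fm_inst. rewrite fm_sub_sub, tsub_lift_cons. now rewrite tsub_comp_id.
Qed.

Lemma fm_sub_inst D G H r (f : tsub S G H) (A : fm S D (r :: G)) t :
  fm_sub f (fm_inst A t) = fm_inst (fm_sub (tsub_lift f) A) (tm_sub f t).
Proof.
  rewrite fm_inst_lift. unfold fm_inst. now rewrite fm_sub_sub, tsub_cons_comp.
Qed.

Lemma ax_sub G H (f : tsub S G H) (A : fm S [] G) : ax A -> ax (fm_sub f A).
Proof.
  destruct 1; cbn;
    rewrite ?fm_sub_wk, ?fm_sub_Imps, ?fm_sub_clause_fm, ?fm_sub_Incl; cbn;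
    try (constructor; assumption).
  - change (ax (All (Imp (fm_sub (tsub_lift f) A)
      (fm_sub (tsub_lift f) (fm_wk (Ex A)))))).
    rewrite fm_sub_wk. apply ax_ex_i.
  - rewrite map_map, (map_ext _ _ (fm_sub_clause_fm f _ _)). apply ax_mu_e.
Qed.

(** Stated for every list that includes the substituted hypotheses, so that the
    identity substitution yields weakening. *)
Lemma derivable_sub G (Hs : list (fm S [] G)) A : derivable Hs A ->
  forall G' (f : tsub S G G') Hs', incl (map (fm_sub f) Hs) Hs' ->
  derivable Hs' (fm_sub f A).
Proof.
  assert (wk : forall G G' (f : tsub S G G') (Hs : list (fm S [] G)) Hs' r,
    incl (map (fm_sub f) Hs) Hs' ->
    incl (map (fm_sub (tsub_lift f)) (map (fm_wk (r := r)) Hs))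
         (map (fm_wk (r := r)) Hs')).
  { intros G0 G' f Hs0 Hs' r I B HB. rewrite map_map in HB.
    apply in_map_iff in HB as (B0 & <- & HB). rewrite fm_sub_wk.
    apply in_map, I, in_map, HB. }
  induction 1; intros G' f Hs' I; cbn.
  - apply d_ass. apply I. now apply in_map.
  - apply d_ax. now apply ax_sub.
  - eapply d_conv; [apply fm_conv_sub|]; eauto.
  - apply d_imp_i. apply IHderivable. cbn.
    apply incl_cons; [now left|]. now apply incl_tl.
  - eapply d_imp_e; [apply (IHderivable1 _ f Hs' I)|auto].
  - apply d_all_i. auto.
  - rewrite fm_sub_inst. apply d_all_e. apply (IHderivable _ f Hs' I).
  - eapply d_var with (r := r). rewrite <- fm_sub_wk. auto.
Qed.

Lemma derivable_weaken G (Hs Hs' : list (fm S [] G)) A :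
  derivable Hs A -> incl Hs Hs' -> derivable Hs' A.
Proof.
  intros HA I. rewrite <- (fm_sub_id A). apply (derivable_sub HA).
  erewrite map_ext; [rewrite map_id; exact I|]. apply fm_sub_id.
Qed.

(** * Classical derivability *)

Lemma c_intro G (Hs : list (fm S [] G)) A : derivable Hs A -> derivable_c Hs A.
Proof. exists []. cbn. now rewrite app_nil_r. Qed.

(** [extends f Hs Hs'] makes [(G', Hs')] a world accessible from [(G, Hs)]. *)
Definition extends {G G' : ctx} (f : tsub S G G') (Hs : list (fm S [] G))
  (Hs' : list (fm S [] G')) : Prop := incl (map (fm_sub f) Hs) Hs'.

Lemma extends_refl G (Hs : list (fm S [] G)) : extends tsub_id Hs Hs.
Proof.
  unfold extends. erewrite map_ext; [rewrite map_id; apply incl_refl|].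
  apply fm_sub_id.
Qed.

Lemma extends_cons G (Hs : list (fm S [] G)) A : extends tsub_id Hs (A :: Hs).
Proof. apply incl_tl, extends_refl. Qed.

Lemma extends_tl G G' (f : tsub S G G') Hs Hs' A :
  extends f Hs Hs' -> extends f Hs (A :: Hs').
Proof. apply incl_tl. Qed.

Lemma extends_map G G' (f : tsub S G G') (Hs : list (fm S [] G)) :
  extends f Hs (map (fm_sub f) Hs).
Proof. apply incl_refl. Qed.

Lemma extends_comp G G' G'' (f : tsub S G G') (g : tsub S G' G'') Hs Hs' Hs'' :
  extends f Hs Hs' -> extends g Hs' Hs'' -> extends (tsub_comp f g) Hs Hs''.
Proof.
  intros I J B HB. apply in_map_iff in HB as (B0 & <- & HB).
  rewrite <- fm_sub_sub. apply J, in_map, I, in_map, HB.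
Qed.

Lemma c_sub G G' (f : tsub S G G') Hs Hs' A :
  extends f Hs Hs' -> derivable_c Hs A -> derivable_c Hs' (fm_sub f A).
Proof.
  intros I [Bs HA]. exists Bs. apply (derivable_sub HA).
  rewrite map_app, map_map. apply incl_app_app; [exact I|].
  erewrite map_ext; [apply incl_refl|]. apply fm_sub_Stab.
Qed.

Lemma c_weaken G (Hs Hs' : list (fm S [] G)) A :
  extends tsub_id Hs Hs' -> derivable_c Hs A -> derivable_c Hs' A.
Proof. intros I HA. rewrite <- (fm_sub_id A). eapply c_sub; eauto. Qed.

Lemma c_ass G (Hs : list (fm S [] G)) A : In A Hs -> derivable_c Hs A.
Proof. intro. now apply c_intro, d_ass. Qed.

Lemma c_conv G (Hs : list (fm S [] G)) A B :
  fm_conv A B -> derivable_c Hs A -> derivable_c Hs B.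
Proof. intros E [Bs HA]. exists Bs. eapply d_conv; eauto. Qed.

Lemma c_imp_i G (Hs : list (fm S [] G)) A B :
  derivable_c (A :: Hs) B -> derivable_c Hs (Imp A B).
Proof. intros [Bs HA]. exists Bs. now apply d_imp_i. Qed.

Lemma c_imp_e G (Hs : list (fm S [] G)) A B :
  derivable_c Hs (Imp A B) -> derivable_c Hs A -> derivable_c Hs B.
Proof.
  intros [Bs HA] [Bs' HB]. exists (Bs ++ Bs'). rewrite map_app.
  eapply d_imp_e; eapply derivable_weaken; eauto.
  - rewrite app_assoc. apply incl_appl, incl_refl.
  - apply incl_app_app; [apply incl_refl|]. apply incl_appr, incl_refl.
Qed.

Lemma c_ax G (Hs : list (fm S [] G)) A : ax A -> derivable_c Hs A.
Proof. intro. now apply c_intro, d_ax. Qed.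

Lemma c_all_i G (Hs : list (fm S [] G)) r (A : fm S [] (r :: G)) :
  derivable_c (map (fm_wk (r := r)) Hs) A -> derivable_c Hs (All A).
Proof.
  intros [Bs HA]. exists Bs. apply d_all_i. rewrite map_app, map_map.
  erewrite (map_ext (fun B => fm_wk (Stab B))); [exact HA|].
  intro. apply fm_sub_Stab.
Qed.

Lemma c_all_e G (Hs : list (fm S [] G)) r (A : fm S [] (r :: G)) t :
  derivable_c Hs (All A) -> derivable_c Hs (fm_inst A t).
Proof. intros [Bs HA]. exists Bs. now apply d_all_e. Qed.

Lemma c_ex_i G (Hs : list (fm S [] G)) r (A : fm S [] (r :: G)) t :
  derivable_c Hs (fm_inst A t) -> derivable_c Hs (Ex A).
Proof.
  intro HA. refine (c_imp_e _ HA).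
  rewrite <- (fm_inst_wk (Ex A) t).
  apply (c_all_e (A := Imp A (fm_wk (Ex A))) t), c_ax, ax_ex_i.
Qed.

Lemma c_and_i G (Hs : list (fm S [] G)) A B :
  derivable_c Hs A -> derivable_c Hs B -> derivable_c Hs (And A B).
Proof.
  intros HA HB. refine (c_imp_e (c_imp_e _ HA) HB). apply c_ax, ax_and_i.
Qed.

Lemma c_and_l G (Hs : list (fm S [] G)) A B :
  derivable_c Hs (And A B) -> derivable_c Hs A.
Proof.
  intro HA. refine (c_imp_e (c_imp_e (c_ax _ ax_and_e) HA) _).
  do 2 apply c_imp_i. apply c_ass. cbn; auto.
Qed.

Lemma c_and_r G (Hs : list (fm S [] G)) A B :
  derivable_c Hs (And A B) -> derivable_c Hs B.
Proof.
  intro HA. refine (c_imp_e (c_imp_e (c_ax _ ax_and_e) HA) _).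
  do 2 apply c_imp_i. apply c_ass. cbn; auto.
Qed.

Lemma c_or_l G (Hs : list (fm S [] G)) A B :
  derivable_c Hs A -> derivable_c Hs (Or A B).
Proof. intro HA. refine (c_imp_e _ HA). apply c_ax, ax_or_l. Qed.

Lemma c_or_r G (Hs : list (fm S [] G)) A B :
  derivable_c Hs B -> derivable_c Hs (Or A B).
Proof. intro HA. refine (c_imp_e _ HA). apply c_ax, ax_or_r. Qed.

(** It suffices to treat the generic extension by the quantified variables
    themselves; having the hypothesis for all extensions and all terms costs
    nothing and spares the users of the lemma reasoning about weakening. *)
Lemma c_alls_i G (Hs : list (fm S [] G)) xs (A : fm S [] (xs ++ G)) :
  (forall G' (f : tsub S G G') Hs' (ts : tms S G' xs), extends f Hs Hs' ->
    derivable_c Hs' (fm_sub (tsub_app ts f) A)) ->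
  derivable_c Hs (Alls xs A).
Proof.
  intro HA.
  specialize (HA _ _ _ (tms_vars (fun _ => @mem_left _ _ _ _))
    (extends_map (tsub_ren (fun _ => @mem_right _ xs G _)) Hs)).
  rewrite tsub_app_vars, fm_sub_id in HA.
  induction xs; cbn in *.
  - change (tsub_ren _) with (@tsub_id S G) in HA.
    erewrite map_ext in HA; [rewrite map_id in HA; exact HA|]. apply fm_sub_id.
  - apply IHxs, c_all_i. rewrite map_map.
    erewrite map_ext; [exact HA|]. intro B. apply fm_sub_sub.
Qed.

Lemma c_alls_e G (Hs : list (fm S [] G)) xs (A : fm S [] (xs ++ G)) ts :
  derivable_c Hs (Alls xs A) ->
  derivable_c Hs (fm_sub (tsub_app ts tsub_id) A).
Proof.
  induction xs; cbn in *; intro HA.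
  - now rewrite fm_sub_id.
  - rewrite <- fm_inst_lift. apply c_all_e. exact (IHxs (All A) (snd ts) HA).
Qed.

Lemma c_exs_i G (Hs : list (fm S [] G)) xs (A : fm S [] (xs ++ G)) ts :
  derivable_c Hs (fm_sub (tsub_app ts tsub_id) A) ->
  derivable_c Hs (Exs xs A).
Proof.
  induction xs; cbn in *; intro HA.
  - now rewrite fm_sub_id in HA.
  - apply (IHxs (Ex A) (snd ts)). apply (c_ex_i _ (fst ts)).
    now rewrite fm_inst_lift.
Qed.

Lemma c_alls_sub_i G0 G (Hs : list (fm S [] G)) (f : tsub S G0 G) xs
  (A : fm S [] (xs ++ G0)) :
  (forall G' (g : tsub S G G') Hs' (ts : tms S G' xs), extends g Hs Hs' ->
    derivable_c Hs' (fm_sub (tsub_app ts (tsub_comp f g)) A)) ->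
  derivable_c Hs (fm_sub f (Alls xs A)).
Proof.
  intro HA. rewrite fm_sub_Alls. apply c_alls_i. intros.
  rewrite fm_sub_sub, tsub_lifts_app. auto.
Qed.

Lemma c_alls_sub_e G0 G (Hs : list (fm S [] G)) (f : tsub S G0 G) xs
  (A : fm S [] (xs ++ G0)) ts :
  derivable_c Hs (fm_sub f (Alls xs A)) ->
  derivable_c Hs (fm_sub (tsub_app ts f) A).
Proof.
  rewrite fm_sub_Alls. intro HA. apply (c_alls_e _ _ ts) in HA.
  now rewrite fm_sub_sub, tsub_lifts_app, tsub_comp_id in HA.
Qed.

Lemma c_exs_sub_i G0 G (Hs : list (fm S [] G)) (f : tsub S G0 G) xs
  (A : fm S [] (xs ++ G0)) ts :
  derivable_c Hs (fm_sub (tsub_app ts f) A) ->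
  derivable_c Hs (fm_sub f (Exs xs A)).
Proof.
  intro HA. rewrite fm_sub_Exs. apply (c_exs_i _ _ ts).
  now rewrite fm_sub_sub, tsub_lifts_app, tsub_comp_id.
Qed.

Lemma c_ex_sub_i G0 G1 G (Hs : list (fm S [] G)) (f : tsub S G0 G1)
  (g : tsub S G1 G) r (A : fm S [] (r :: G0)) (ts : tms S G [r]) :
  derivable_c Hs (fm_sub (tsub_app ts (tsub_comp f g)) A) ->
  derivable_c Hs (fm_sub g (fm_sub f (Ex A))).
Proof. rewrite fm_sub_sub. apply (c_exs_sub_i _ [r]). Qed.

Lemma c_closed_alls_e G (Hs : list (fm S [] G)) xs (A : fm S [] xs) ts :
  derivable_c Hs (Alls xs (fm_left A)) ->
  derivable_c Hs (fm_sub (tsub_of ts) A).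
Proof.
  intro HA. apply (c_alls_e _ _ ts) in HA. now rewrite fm_sub_app_left in HA.
Qed.

Lemma c_use_stab G (Hs : list (fm S [] G)) (B : {xs : ctx & fm S [] xs}) A :
  derivable_c (Stab B :: Hs) A -> derivable_c Hs A.
Proof.
  intros [Bs HA]. exists (B :: Bs). apply (derivable_weaken HA).
  intros D [<- | HD]; apply in_or_app; [right; now left|].
  apply in_app_or in HD as []; [now left|right; now right].
Qed.

(** The classical principle, for formulas with free variables: the universal
    closure of stability is instantiated with the variables themselves. *)
Lemma c_stab G (Hs : list (fm S [] G)) A :
  derivable_c Hs (Neg (Neg A)) -> derivable_c Hs A.
Proof.
  apply c_imp_e. apply (c_use_stab (existT _ G A)).
  rewrite <- (fm_sub_id (Imp _ _)), <- tsub_of_id.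
  apply c_closed_alls_e, c_ass. now left.
Qed.

Lemma c_contra G (Hs : list (fm S [] G)) A :
  derivable_c (Neg A :: Hs) Bot -> derivable_c Hs A.
Proof. intro HA. now apply c_stab, c_imp_i. Qed.

Lemma c_absurd G (Hs : list (fm S [] G)) A :
  derivable_c Hs Bot -> derivable_c Hs A.
Proof. intro HA. apply c_contra. exact (c_weaken (extends_cons _ _) HA). Qed.

Lemma c_conj_i G (Hs : list (fm S [] G)) As :
  Forall (derivable_c Hs) As -> derivable_c Hs (Conj As).
Proof.
  intro HAs. induction HAs as [|A As HA HAs IH].
  - apply c_imp_i, c_ass. now left.
  - destruct As; cbn in *; auto. now apply c_and_i.
Qed.

Lemma c_conj_e G (Hs : list (fm S [] G)) As :
  derivable_c Hs (Conj As) -> Forall (derivable_c Hs) As.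
Proof.
  induction As as [|A As IH]; intro HA; constructor;
    destruct As; cbn in *; eauto using c_and_l, c_and_r.
Qed.

Lemma c_neg_conj_i G (Hs : list (fm S [] G)) As :
  (forall Hs', extends tsub_id Hs Hs' -> Forall (derivable_c Hs') As ->
    derivable_c Hs' Bot) ->
  derivable_c Hs (Neg (Conj As)).
Proof.
  intro HAs. apply c_imp_i, HAs; [apply extends_cons|].
  apply c_conj_e, c_ass. now left.
Qed.

Lemma c_disj_i G (Hs : list (fm S [] G)) As A :
  In A As -> derivable_c Hs A -> derivable_c Hs (Disj As).
Proof.
  intros I HA. induction As as [|B As IH]; [easy|].
  destruct I as [-> | I].
  - destruct As; auto. now apply c_or_l.
  - destruct As; [easy|]. now apply c_or_r, IH.
Qed.

Lemma c_imps_e G (Hs : list (fm S [] G)) As A :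
  derivable_c Hs (Imps As A) -> Forall (derivable_c Hs) As -> derivable_c Hs A.
Proof.
  intros HA HAs. induction HAs; cbn in *; auto.
  apply IHHAs. eapply c_imp_e; eauto.
Qed.

(** * Inclusions *)

Lemma c_incl_i G (Hs : list (fm S [] G)) ar (P Q : pred S [] ar) :
  (forall G' (f : tsub S G G') Hs' ts, extends f Hs Hs' ->
    derivable_c Hs' (Pr P ts) -> derivable_c Hs' (Pr Q ts)) ->
  derivable_c Hs (Incl P Q).
Proof.
  intro HPQ. rewrite Incl_left. apply c_alls_i. intros G' f Hs' ts I.
  rewrite fm_sub_app_left. cbn. rewrite tms_sub_of_vars.
  apply c_imp_i, (HPQ _ f); [now apply extends_tl|]. apply c_ass. now left.
Qed.

Lemma c_incl_e G (Hs : list (fm S [] G)) ar (P Q : pred S [] ar) ts :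
  derivable_c Hs (Incl P Q) -> derivable_c Hs (Pr P ts) ->
  derivable_c Hs (Pr Q ts).
Proof.
  intro HPQ. rewrite Incl_left in HPQ. apply (c_closed_alls_e _ ts) in HPQ.
  cbn in HPQ. rewrite tms_sub_of_vars in HPQ. now apply c_imp_e.
Qed.

Lemma c_compr G (Hs : list (fm S [] G)) ar (A : fm S [] ar) ts :
  derivable_c Hs (Pr (Compr A) ts) <-> derivable_c Hs (fm_sub (tsub_of ts) A).
Proof.
  split; apply c_conv; [|apply fc_sym]; apply fc_compr.
Qed.

(** * Equality *)

Lemma c_eq_refl G (Hs : list (fm S [] G)) r (t : tm S G r) :
  derivable_c Hs (Pr (Eq r) (t, (t, tt))).
Proof.
  pose (c := @Cl S [[r; r]] [r; r] [r] [] (Var mz, (Var mz, tt))).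
  assert (HE : derivable_c Hs (clause_fm (Eq r) (Eq r) c)).
  { apply c_ax. now apply (@ax_mu_i S G _ [c]); left. }
  exact (c_closed_alls_e (xs := [r]) (Pr (Eq r) (Var mz, (Var mz, tt)))
    (t, tt) HE).
Qed.

Lemma c_eqs_refl G (Hs : list (fm S [] G)) ar (ts : tms S G ar) :
  derivable_c Hs (Eqs ts ts).
Proof.
  apply c_conj_i. induction ar; cbn; constructor; auto. apply c_eq_refl.
Qed.

(** Leibniz substitution in a formula with parameters.  The predicate in the
    induction axiom for equality has no parameters, so the parameters [G] of [A]
    are universally quantified: for [P a b] take
    [forall z, A(a, z) -> A(b, z)]. *)
Lemma c_eq_subst G (Hs : list (fm S [] G)) r (s t : tm S G r)
  (A : fm S [] (r :: G)) :
  derivable_c Hs (Pr (Eq r) (s, (t, tt))) ->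
  derivable_c Hs (fm_inst A s) -> derivable_c Hs (fm_inst A t).
Proof.
  intros E.
  pose (A' x := fm_sub (tsub_cons (Var (mem_right G x))
    (fun _ y => Var (mem_left y))) A : fm S [] (G ++ [r; r])).
  assert (HA' : forall G' (us : tms S G' G) f x,
    fm_sub (tsub_app us f) (A' x) = fm_sub (tsub_cons (f _ x) (tsub_of us)) A).
  { intros. unfold A'. rewrite fm_sub_sub, tsub_cons_comp. cbn.
    rewrite tsub_app_right. do 2 f_equal. apply mem_fun_ext. intros.
    apply tsub_app_left. }
  pose (P := Compr (Alls G (Imp (A' mz) (A' (ms mz))))).
  assert (HP : derivable_c Hs (Incl (Eq r) P)).
  { eapply c_imps_e; [apply c_ax, ax_mu_e|]. constructor; [|constructor].
    apply c_alls_i. intros G' f Hs' ts I. rewrite fm_sub_app_left.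
    apply c_compr, c_alls_sub_i. intros G'' g Hs'' us J.
    cbn [fm_sub]. rewrite !HA'. apply c_imp_i, c_ass. now left. }
  apply c_imp_e. apply (c_incl_e _ HP), c_compr in E.
  apply (c_alls_sub_e _ _ _ (tms_vars (fun _ x => x))) in E.
  cbn [fm_sub] in E. now rewrite !HA', tsub_of_id in E.
Qed.

Lemma c_eqs_subst G (Hs : list (fm S [] G)) ar : forall (ts us : tms S G ar)
  (A : fm S [] (ar ++ G)),
  derivable_c Hs (Eqs ts us) ->
  derivable_c Hs (fm_sub (tsub_app ts tsub_id) A) ->
  derivable_c Hs (fm_sub (tsub_app us tsub_id) A).
Proof.
  intros ts us A E. apply c_conj_e in E.
  induction ar; cbn in *; [auto|]. inversion_clear E as [|? ? E1 E2].
  rewrite <- !fm_inst_lift. intro HA. apply (c_eq_subst _ E1) in HA.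
  rewrite fm_inst_lift in *.
  (* With the first equation used, [fst us], weakened by the block [ar], is
     substituted into [A] once and for all; the rest is an instance of the
     induction hypothesis. *)
  pose (u := tm_sub (tsub_ren (fun _ => @mem_right _ ar G _)) (fst us)).
  enough (HB : forall vs,
    fm_sub (tsub_app vs tsub_id) (fm_sub (tsub_cons u tsub_id) A) =
    fm_sub (tsub_cons (fst us) (tsub_app vs tsub_id)) A).
  { rewrite <- HB in *. exact (IHar _ _ _ E2 HA). }
  intro. unfold u. rewrite fm_sub_sub, tsub_cons_comp, tm_sub_sub.
  do 2 f_equal. rewrite <- (tm_sub_id (fst us)) at 2. f_equal.
  apply mem_fun_ext. intros. apply tsub_app_right.
Qed.

Lemma c_neg_pr_subst G (Hs : list (fm S [] G)) ar (P : pred S [] ar)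
  (ts us : tms S G ar) :
  derivable_c Hs (Eqs ts us) -> derivable_c Hs (Neg (Pr P ts)) ->
  derivable_c Hs (Neg (Pr P us)).
Proof.
  intros E HP.
  pose (A := fm_left (Neg (Pr P (tms_vars (fun _ x => x))))
    : fm S [] (ar ++ G)).
  assert (HA : forall vs, fm_sub (tsub_app vs tsub_id) A = Neg (Pr P vs)).
  { intro. unfold A. rewrite fm_sub_app_left. cbn.
    now rewrite tms_sub_of_vars. }
  rewrite <- HA in *. exact (c_eqs_subst _ _ _ A E HP).
Qed.

(** * Fixed points *)

Lemma c_mu_i G (Hs : list (fm S [] G)) ar (K : list (clause S [ar] ar)) xs As
  (ts : tms S xs ar) (vs : tms S G xs) :
  In (Cl As ts) K ->
  Forall (fun A =>
    derivable_c Hs (fm_sub (tsub_of vs) (fm_pinst (Mu K) A))) As ->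
  derivable_c Hs (Pr (Mu K) (tms_sub (tsub_of vs) ts)).
Proof.
  intros I HAs.
  assert (HK : derivable_c Hs (clause_fm (Mu K) (Mu K) (Cl As ts)))
    by now apply c_ax, ax_mu_i.
  apply (c_closed_alls_e _ vs) in HK. rewrite fm_sub_Imps in HK.
  apply (c_imps_e _ HK). now rewrite !Forall_map.
Qed.

Lemma c_phi_i G (Hs : list (fm S [] G)) ar (K : list (clause S [ar] ar)) xs As
  (ts : tms S xs ar) (P : pred S [] ar) (us : tms S G ar) (vs : tms S G xs) :
  In (Cl As ts) K -> derivable_c Hs (Eqs us (tms_sub (tsub_of vs) ts)) ->
  derivable_c Hs
    (Conj (map (fun A => fm_sub (tsub_of vs) (fm_pinst P A)) As)) ->
  derivable_c Hs (Pr (Phi K P) us).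
Proof.
  intros I E HAs. apply c_compr. rewrite fm_sub_Disj.
  eapply c_disj_i; [apply in_map, in_map, I|].
  apply c_exs_sub_i with (ts := vs). cbn [fm_sub].
  rewrite fm_sub_app_vars_eq, fm_sub_app_left, fm_sub_Conj, map_map.
  now apply c_and_i.
Qed.

(** Together with [c_phi_single], the axioms in the case of the fixed points
    that occur as strong negations: a single clause, of conclusion [X y] with
    distinct variables [y], says the same as its premise. *)
Lemma c_mu_single G (Hs : list (fm S [] G)) ar (B : fm S [ar] ar)
  (us : tms S G ar) :
  let M := Mu [Cl [B] (tms_vars (fun _ x => x))] in
  derivable_c Hs (fm_sub (tsub_of us) (fm_pinst M B)) ->
  derivable_c Hs (Pr M us).
Proof.
  intros M HB. rewrite <- (tms_sub_of_vars _ _ us).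
  eapply c_mu_i; [now left|]. now constructor.
Qed.

Lemma c_phi_single G (Hs : list (fm S [] G)) ar (B : fm S [ar] ar)
  (P : pred S [] ar) (us : tms S G ar) :
  derivable_c Hs (fm_sub (tsub_of us) (fm_pinst P B)) ->
  derivable_c Hs (Pr (Phi [Cl [B] (tms_vars (fun _ x => x))] P) us).
Proof.
  intros HB. eapply c_phi_i; [now left| |exact HB].
  rewrite tms_sub_of_vars. apply c_eqs_refl.
Qed.

Definition Compl {ar} (P : pred S [] ar) : pred S [] ar :=
  Compr (Neg (Pr P (tms_vars (fun _ x => x)))).

Lemma c_compl G (Hs : list (fm S [] G)) ar (P : pred S [] ar) ts :
  derivable_c Hs (Pr (Compl P) ts) <-> derivable_c Hs (Neg (Pr P ts)).
Proof.
  unfold Compl. rewrite c_compr. cbn. now rewrite tms_sub_of_vars.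
Qed.

Lemma c_cup_r G (Hs : list (fm S [] G)) ar (P Q : pred S [] ar) ts :
  derivable_c Hs (Pr Q ts) -> derivable_c Hs (Pr (Cup P Q) ts).
Proof.
  intro HQ. apply c_compr. cbn. apply c_or_r. now rewrite tms_sub_of_vars.
Qed.

(** * Strong negation *)

(** The complement of [P] is included in [Q], in all extensions of [Hs].  As the
    predicates are closed, substitutions need not act on them. *)
Definition neg_incl {G : ctx} (Hs : list (fm S [] G)) {ar} (P Q : pred S [] ar)
  : Prop := forall G' (s : tsub S G G') Hs' ts, extends s Hs Hs' ->
  derivable_c Hs' (Neg (Pr P ts)) -> derivable_c Hs' (Pr Q ts).

Lemma neg_incl_extends G G' (s : tsub S G G') Hs Hs' ar (P Q : pred S [] ar) :
  extends s Hs Hs' -> neg_incl Hs P Q -> neg_incl Hs' P Q.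
Proof.
  intros I HPQ G'' s' Hs'' ts J. exact (HPQ _ _ _ _ (extends_comp I J)).
Qed.

(** The classical de Morgan law, proved by contradiction: if no [F' A] held, then
    each [F A] would hold, again by contradiction. *)
Lemma c_disj_of_neg_conj G (Hs : list (fm S [] G)) T (F F' : T -> fm S [] G)
  (As : list T) :
  Forall (fun A => forall Hs', extends tsub_id Hs Hs' ->
    derivable_c Hs' (Neg (F A)) -> derivable_c Hs' (F' A)) As ->
  derivable_c Hs (Neg (Conj (map F As))) -> derivable_c Hs (Disj (map F' As)).
Proof.
  intros HAs HC. apply c_contra.
  refine (c_imp_e (c_weaken (extends_cons _ _) HC) _).
  apply c_conj_i, Forall_map, Forall_forall. intros A HA. apply c_contra.
  eapply c_imp_e; [apply c_ass; right; now left|].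
  apply (c_disj_i _ (in_map F' _ _ HA)).
  rewrite Forall_forall in HAs. apply (HAs A HA).
  - apply extends_tl, extends_cons.
  - apply c_ass. now left.
Qed.

(** In an arbitrary extension, the quantified variables of the clause become
    terms [vs] and the equation [y == t] a hypothesis on them. *)
Lemma c_clause_sneg_i D G (Hs : list (fm S [] G)) (h : psub D []) ar xs As
  (ts : tms S xs ar) (us : tms S G ar) :
  (forall G' (s : tsub S G G') Hs' (vs : tms S G' xs), extends s Hs Hs' ->
    derivable_c Hs' (Eqs (tms_sub s us) (tms_sub (tsub_of vs) ts)) ->
    derivable_c Hs'
      (Disj (map (fun A => fm_sub (tsub_of vs) (fm_psub h (fm_sneg A))) As))) ->
  derivable_c Hs (fm_sub (tsub_of us) (fm_psub h (clause_sneg (Cl As ts)))).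
Proof.
  intro HAs. cbn [clause_sneg]. rewrite fm_psub_Alls. apply c_alls_sub_i.
  intros G' s Hs' vs I. cbn [fm_psub fm_sub].
  unfold fm_left at 1, fm_ren. rewrite fm_psub_sub.
  change (fm_sub (tsub_ren _) ?A) with (@fm_left S [] xs ar A).
  rewrite fm_sub_app_left, fm_psub_Disj, fm_sub_Disj, !map_map.
  change (fm_pren _ ?A) with (@fm_open S [] _ A).
  apply c_imp_i. apply HAs with (s := s).
  - now apply extends_tl.
  - rewrite <- fm_sub_app_vars_eq, <- tsub_of_comp. apply c_ass. now left.
Qed.

(** The induction hypothesis.  [f] and [g] interpret the bound predicate
    variables in [A] and in its strong negation, respectively; [s] interprets
    the term variables in an arbitrary world. *)
Definition neg_sneg_fm D G0 (A : fm S D G0) : Prop :=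
  forall (f g : psub D []) G (Hs : list (fm S [] G)) (s : tsub S G0 G),
  (forall ar X, neg_incl Hs (f ar X) (g ar X)) ->
  (forall Y, In Y (fm_PP A) -> neg_incl Hs (PVar Y) (PVar (prime Y))) ->
  derivable_c Hs (Neg (fm_sub s (fm_psub f A))) ->
  derivable_c Hs (fm_sub s (fm_psub g (fm_sneg A))).

Definition neg_sneg_pred D ar (P : pred S D ar) : Prop :=
  forall (f g : psub D []) G (Hs : list (fm S [] G)),
  (forall ar X, neg_incl Hs (f ar X) (g ar X)) ->
  (forall Y, In Y (pred_PP P) -> neg_incl Hs (PVar Y) (PVar (prime Y))) ->
  neg_incl Hs (pred_psub f P) (pred_psub g (pred_sneg P)).

(** The common core of both fixed point cases, with [P] and [P'] put for the
    bound variable of the clauses and of their strong negations: if no clause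
    yields [us] from [P], then the premise of the single clause of the strong
    negation holds at [us] for [P']. *)
Lemma fixed_point_step D ar (K : list (clause S (ar :: D) ar)) (f g : psub D [])
  (P P' : pred S [] ar) G (Hs : list (fm S [] G)) (us : tms S G ar) :
  Forall (on_premises neg_sneg_fm) K ->
  (forall ar X, neg_incl Hs (f ar X) (g ar X)) ->
  (forall Y, In Y (flat_map clause_PP K) ->
    neg_incl Hs (PVar Y) (PVar (prime Y))) ->
  neg_incl Hs P P' ->
  (forall xs As (ts : tms S xs ar) G' (s : tsub S G G') Hs' (vs : tms S G' xs),
    In (Cl As ts) K -> extends s Hs Hs' ->
    derivable_c Hs' (Eqs (tms_sub s us) (tms_sub (tsub_of vs) ts)) ->
    derivable_c Hs' (Neg (Conj
      (map (fun A => fm_sub (tsub_of vs) (fm_psub (psub_cons P f) A)) As)))) ->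
  derivable_c Hs (fm_sub (tsub_of us)
    (fm_pinst P' (fm_psub (psub_lift g) (Conj (map clause_sneg K))))).
Proof.
  intros IH Hfg HPP HP HK.
  rewrite pinst_psub_lift, fm_psub_Conj, fm_sub_Conj, !map_map.
  apply c_conj_i, Forall_map, Forall_forall. intros c Hc.
  destruct (clause_cl c) as (xs & As & ts & ->).
  rewrite Forall_forall in IH. specialize (IH _ Hc). cbn in IH.
  apply c_clause_sneg_i. intros G' s Hs' vs I E.
  eapply c_disj_of_neg_conj; [|exact (HK _ _ _ _ _ _ _ Hc I E)].
  rewrite Forall_forall in *. intros A HA Hs'' J.
  pose proof (extends_comp I J) as IJ.
  apply (IH A HA).
  - apply mem_cons_case; cbn; intros; now apply (neg_incl_extends IJ).
  - intros Y HY. apply (neg_incl_extends IJ), HPP, in_flat_map.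
    exists (Cl As ts). split; auto. apply in_flat_map. eauto.
Qed.

(** Coinduction with the complement of the least fixed point. *)
Lemma neg_sneg_mu D ar (K : list (clause S (ar :: D) ar)) :
  Forall (on_premises neg_sneg_fm) K -> neg_sneg_pred (Mu K).
Proof.
  intros IH f g G Hs Hfg HPP. cbn. set (M := Mu _). set (N := Nu _).
  assert (HN : derivable_c Hs (Incl (Compl M) N)).
  { eapply c_imp_e; [apply c_ax, ax_nu_i|]. apply c_incl_i.
    intros G' s Hs' us I HM. apply c_compl in HM. apply c_phi_single.
    apply fixed_point_step with (f := f) (P := M); auto.
    - intros. now apply (neg_incl_extends I).
    - intros. now apply (neg_incl_extends I), HPP.
    - intros G'' t Hs'' ts J Hts. now apply c_cup_r, c_compl.
    - (* If all premises held for [M], so would the conclusion [M ts], and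
         [M us] by the equation. *)
      intros xs As ts G'' t Hs'' vs Hc J E. apply c_neg_conj_i.
      intros Hs3 L HAs. apply (c_sub J) in HM. cbn in HM.
      apply (c_neg_pr_subst _ E), (c_weaken L) in HM. apply (c_imp_e HM).
      eapply c_mu_i; [exact (in_clause_psub (psub_lift f) _ _ _ Hc)|].
      rewrite Forall_map in *. revert HAs. apply Forall_impl. intro A.
      now rewrite pinst_psub_lift. }
  intros G' s Hs' ts I HM. apply c_compl in HM. refine (c_incl_e _ _ HM).
  rewrite <- (fm_sub_Incl s). now apply (c_sub I).
Qed.

(** By contraposition: the complement of the strong negation is included in the
    greatest fixed point, by coinduction. *)
Lemma neg_sneg_nu D ar (K : list (clause S (ar :: D) ar)) :
  Forall (on_premises neg_sneg_fm) K -> neg_sneg_pred (Nu K).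
Proof.
  intros IH f g G Hs Hfg HPP. cbn. set (N := Nu _). set (M := Mu _).
  assert (HN : derivable_c Hs (Incl (Compl M) N)).
  { eapply c_imp_e; [apply c_ax, ax_nu_i|]. apply c_incl_i.
    intros G' s Hs' us I HM. apply c_compl in HM. apply c_contra.
    (* Assuming that no clause yields [us], [M us] is derived. *)
    refine (c_imp_e (c_weaken (extends_cons _ _) HM) _). apply c_mu_single.
    match goal with |- derivable_c (?A :: _) _ => apply (extends_tl A) in I end.
    apply fixed_point_step with (f := f) (P := Cup N (Compl M)); auto.
    - intros. now apply (neg_incl_extends I).
    - intros. now apply (neg_incl_extends I), HPP.
    - intros G'' t Hs'' ts J Hts. apply c_contra.
      refine (c_imp_e (c_weaken (extends_cons _ _) Hts) _).
      apply c_cup_r, c_compl, c_ass. now left.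
    - intros xs As ts G'' t Hs'' vs Hc J E. apply c_imp_i.
      eapply c_imp_e.
      + apply c_ass. right. apply J. now left.
      + eapply c_phi_i; [exact (in_clause_psub (psub_lift f) _ _ _ Hc)| |].
        * apply (c_weaken (extends_cons _ _) E).
        * apply c_ass. left. rewrite map_map. f_equal. apply map_ext. intro.
          now rewrite pinst_psub_lift. }
  intros G' s Hs' ts I HM. apply c_contra.
  refine (c_imp_e (c_weaken (extends_cons _ _) HM) _).
  apply (c_incl_e (P := Compl M)).
  - rewrite <- (fm_sub_Incl s). apply (c_sub (extends_tl _ I)), HN.
  - apply c_compl, c_ass. now left.
Qed.

Lemma neg_sneg :
  (forall D G (A : fm S D G), neg_sneg_fm A) /\
  (forall D ar (P : pred S D ar), neg_sneg_pred P).
Proof.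
  apply fm_pred_mutind.
  - intros D G0 ar P ts IH f g G Hs s Hfg HPP. cbn.
    exact (IH f g G Hs Hfg HPP _ _ _ _ (extends_refl Hs)).
  - intros D G0 A B _ IHB f g G Hs s Hfg HPP HAB. cbn in *.
    change (fm_pren _ A) with (@fm_open S D _ A). rewrite psub_open.
    apply c_and_i.
    + (* If [A] failed, the implication would hold vacuously. *)
      apply c_contra. refine (c_imp_e (c_weaken (extends_cons _ _) HAB) _).
      apply c_imp_i, c_absurd.
      eapply c_imp_e; apply c_ass; [right; left|left]; reflexivity.
    + apply (IHB f); auto. apply c_imp_i.
      refine (c_imp_e (c_weaken (extends_cons _ _) HAB) _).
      apply c_imp_i, c_ass. right. now left.
  - intros D G0 A B IHA IHB f g G Hs s Hfg HPP HAB. cbn in *.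
    apply c_disj_of_neg_conj with (As := [A; B])
      (F := fun A => fm_sub s (fm_psub f A))
      (F' := fun A => fm_sub s (fm_psub g (fm_sneg A))); auto.
    repeat constructor; intros Hs' I; [apply IHA|apply IHB];
      auto using in_or_app; intros; eapply neg_incl_extends;
      eauto using in_or_app.
  - intros D G0 A B IHA IHB f g G Hs s Hfg HPP HAB. cbn in *.
    apply c_and_i; [apply (IHA f)|apply (IHB f)]; auto using in_or_app;
      apply c_imp_i; refine (c_imp_e (c_weaken (extends_cons _ _) HAB) _);
      [apply c_or_l|apply c_or_r]; apply c_ass; now left.
  - intros D G0 r A IH f g G Hs s Hfg HPP HA. cbn [fm_sneg fm_psub] in *.
    apply c_contra. refine (c_imp_e (c_weaken (extends_cons _ _) HA) _).
    apply (c_alls_sub_i _ [r]). intros G' h Hs' ts I. apply c_contra.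
    destruct (incl_cons_inv I) as [_ J].
    eapply c_imp_e; [apply c_ass; right; apply I; now left|].
    apply c_ex_sub_i with (ts := ts), (IH f).
    + intros. now apply (neg_incl_extends (extends_tl _ J)).
    + intros. now apply (neg_incl_extends (extends_tl _ J)), HPP.
    + apply c_ass. now left.
  - intros D G0 r A IH f g G Hs s Hfg HPP HA. cbn [fm_sneg fm_psub] in *.
    apply (c_alls_sub_i _ [r]). intros G' h Hs' ts I. apply (IH f).
    + intros. now apply (neg_incl_extends I).
    + intros. now apply (neg_incl_extends I), HPP.
    + apply c_imp_i. apply (c_sub I) in HA.
      refine (c_imp_e (c_weaken (extends_cons _ _) HA) _).
      apply c_ex_sub_i with (ts := ts), c_ass. now left.
  - intros D X f g G Hs Hfg HPP. apply HPP. now left.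
  - intros D ar X f g G Hs Hfg HPP. apply Hfg.
  - intros D ar A IH f g G Hs Hfg HPP G' s Hs' ts I HA. cbn.
    apply c_compr, (IH f).
    + intros. now apply (neg_incl_extends I).
    + intros. now apply (neg_incl_extends I), HPP.
    + apply c_imp_i. refine (c_imp_e (c_weaken (extends_cons _ _) HA) _).
      apply c_compr, c_ass. now left.
  - intros. now apply neg_sneg_mu.
  - intros. now apply neg_sneg_nu.
Qed.

End Derivations.

Theorem lemma4p15 (S : signature) (G : ctx) (A : fm S nil G) :
  derivable_c (map neg_to_prime (fm_PP A)) (Imp (Neg A) (fm_sneg A)).
Proof.
  rewrite <- (fm_sub_id (fm_sneg A)), <- (proj1 psub_id _ _ (fm_sneg A)).
  apply c_imp_i, (proj1 neg_sneg _ _ A (fun _ X => PBnd X)).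
  - intros ar X. exact (mem_nil X).
  - intros Y HY G' s Hs' ts I HN.
    assert (HH : derivable_c Hs' (neg_to_prime Y)).
    { apply c_ass.
      rewrite neg_to_prime_left, <- (fm_sub_Alls_left s), <- neg_to_prime_left.
      apply I, in_map. right. now apply in_map. }
    rewrite neg_to_prime_left in HH. apply (c_closed_alls_e _ ts) in HH.
    cbn in HH. rewrite tms_sub_of_vars in HH. exact (c_imp_e HH HN).
  - rewrite (proj1 psub_id), fm_sub_id. apply c_ass. now left.
Qed.
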